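(* Let $A$ be a set, let $H$ be a finitely generated subgroup of the free group $F_A$ on $A$, and let $k\geq 1$. Let $\mathbf{S}_k$ be the pseudovariety of all finite $k$-solvable groups. Then: (i) $\mathrm{Cl}_{\mathbf{S}_k}(H)\geq HF_A^{(k)}$; (ii) if $A$ is infinite, then $\mathrm{Cl}_{\mathbf{S}_k}(H)$ is not finitely generated; (iii) if $A$ is finite, then $\mathrm{Cl}_{\mathbf{S}_k}(H)$ is finitely generated if and only if it has finite index in $F_A$; (iv) it is decidable whether or not $H$ is $\mathbf{S}_k$-closed.
   Context: For a group $G$, $G^{(k)}$ denotes the $k$-th derived subgroup ($G^{(1)}=G'=[G,G]$, $G^{(k+1)}=(G^{(k)})'$). A group $G$ is $k$-solvable if $G^{(k)}=1$. A pseudovariety (of finite groups) is a class of finite groups closed under taking subgroups, homomorphic images and finitary direct products. For a pseudovariety $\mathbf{V}$, the pro-$\mathbf{V}$ topology on a group $G$ is the coarsest topology making all homomorphisms from $G$ to elements of $\mathbf{V}$ (with the discrete topology) continuous; equivalently, the normal subgroups $K$ of $G$ with $G/K\in\mathbf{V}$ form a basis of neighbourhoods of the identity. $\mathrm{Cl}_{\mathbf{V}}(H)$ denotes the closure of $H$ in the pro-$\mathbf{V}$ topology on $F_A$; $H$ is $\mathbf{V}$-closed if it equals this closure. Decidability convention: the basis $A$ of the free group is fixed, and the input is a finite generating set of $H$, given as reduced words over $A\cup A^{-1}$.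
   Formalization: Part (iii) excludes the case where A has exactly one element and H is trivial: there F_A = Z and the closure of H is trivial, hence finitely generated but of infinite index, so (iii) as stated fails in exactly this case. *)

(* Defs.v *)
From HB Require Import structures.
From mathcomp Require Import all_boot all_fingroup commutator.
From mathcomp Require Import boolp classical_sets functions cardinality filter.
From mathcomp Require Import topology.

Set Implicit Arguments.
Unset Strict Implicit.
Unset Printing Implicit Defensive.

Local Open Scope classical_set_scope.
Local Open Scope group_scope.

Section Subgroups.
Variable G : groupType.
Implicit Types (S H K : set G).

Definition is_subgroup H : Prop := H 1 /\ forall x y, H x -> H y -> H (x * y^-1).

Definition generated S : set G := smallest is_subgroup S.

Definition finitely_generated H : Prop :=
  exists2 S : set G, finite_set S & H = generated S.

Definition coset_set H : set (set G) := range (fun x => [set h * x | h in H]).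

Definition finite_index H : Prop := finite_set (coset_set H).

Definition set_prod H K : set G := [set x * y | x in H & y in K].

Definition commutator_subgroup H K : set G :=
  generated [set [~ x, y] | x in H & y in K].

Definition derived_subgroup (k : nat) : set G :=
  iter k (fun H => commutator_subgroup H H) setT.

End Subgroups.

Arguments derived_subgroup : clear implicits.

(* The empty product is the trivial group, whence pv_trivial. Closure under   *)
(* isomorphism is an instance of pv_image.                                    *)
Record pseudovariety := Pseudovariety {
  pv_mem :> finGroupType -> Prop;
  pv_trivial : forall gT : finGroupType, #|gT| = 1%N -> pv_mem gT;
  pv_subgroup : forall (gT : finGroupType) (H : {group gT}),
    pv_mem gT -> pv_mem (subg_of H);
  pv_image : forall (gT rT : finGroupType) (f : {multiplicative gT -> rT}),
    range f = setT -> pv_mem gT -> pv_mem rT;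
  pv_product : forall gT rT : finGroupType,
    pv_mem gT -> pv_mem rT -> pv_mem (gT * rT)%type
}.

Definition k_solvable (k : nat) (gT : finGroupType) : Prop :=
  [set: gT]%SET^`(k) = 1.

Lemma k_solvable_trivial k (gT : finGroupType) :
  #|gT| = 1%N -> k_solvable k gT.
Proof.
rewrite /k_solvable => gT1; apply/trivgP; apply/fintype.subsetP => x _.
rewrite inE; apply/eqP.
exact: (fintype_le1P (eq_leq gT1)).
Qed.

Lemma k_solvable_subgroup k (gT : finGroupType) (H : {group gT}) :
  k_solvable k gT -> k_solvable k (subg_of H).
Proof.
rewrite /k_solvable => gTk; apply: (injm_morphim_inj (injm_sgval H)).
- exact: finset.subsetT.
- exact: finset.subsetT.
rewrite morphim1 morphim_der ?finset.subsetT //; apply/trivgP.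
by rewrite -gTk; apply: dergS; apply: finset.subsetT.
Qed.

Lemma k_solvable_image k (gT rT : finGroupType)
    (f : {multiplicative gT -> rT}) :
  range f = setT -> k_solvable k gT -> k_solvable k rT.
Proof.
move=> fT gTk; rewrite /k_solvable.
have fM : {in [set: gT]%SET &, {morph f : x y / x * y}}.
  by move=> x y _ _; rewrite gmulfM.
pose F := Morphism fM.
have -> : [set: rT]%SET = F @* [set: gT]%SET.
  apply/setP => y; rewrite finset.in_setT; apply/esym/morphimP.
  have : range f y by rewrite fT.
  by case=> x _ <-; exists x.
by rewrite -morphim_der // gTk morphim1.
Qed.

Lemma k_solvable_product k (gT rT : finGroupType) :
  k_solvable k gT -> k_solvable k rT ->
  k_solvable k (gT * rT)%type.
Proof.
rewrite /k_solvable => gTk rTk.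
have der1 (aT : finGroupType) (F : {morphism [set: gT * rT] >-> aT}) :
    [set: aT]%SET^`(k) = 1 -> F @* [set: gT * rT]%SET^`(k) = 1.
  move=> aTk; rewrite morphim_der //; apply/trivgP.
  by rewrite -aTk; apply: dergS; apply: finset.subsetT.
apply/trivgP/fintype.subsetP => -[x y] xyk; rewrite inE; apply/eqP.
have := der1 _ [morphism of fst] gTk; have := der1 _ [morphism of snd] rTk.
move=> /setP/(_ y) y1 /setP/(_ x) x1.
have /esym : x \in [1 gT] by rewrite -x1; apply/morphimP; exists (x, y).
have /esym : y \in [1 rT] by rewrite -y1; apply/morphimP; exists (x, y).
by rewrite !inE => /esym/eqP -> /esym/eqP ->.
Qed.

Definition finite_solvable (k : nat) : pseudovariety :=
  Pseudovariety (@k_solvable_trivial k)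
    (@k_solvable_subgroup k) (@k_solvable_image k)
    (@k_solvable_product k).

Definition pro (V : pseudovariety) (G : groupType) : Type := G.

Section ProTopology.
Variables (V : pseudovariety) (G : groupType).

(* The open sets of the discrete group gT are all its subsets.                *)
Definition pro_subbase : set (set G) :=
  [set U | exists (gT : finGroupType) (f : {multiplicative G -> gT})
             (X : set gT), V gT /\ U = f @^-1` X].

HB.instance Definition _ := Choice.on (pro V G).
HB.instance Definition _ :=
  isSubBaseTopological.Build (pro V G) pro_subbase (@id (set G)).

Definition pro_closure (H : set G) : set G := closure (H : set (pro V G)).

Definition pro_closed (H : set G) : Prop := pro_closure H = H.

End ProTopology.

Section FreeGroup.
Variable A : choiceType.

(* (a, true) stands for a and (a, false) for its inverse.                     *)
Definition letter : Type := (A * bool)%type.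

HB.instance Definition _ := Choice.on letter.

Definition letter_inv (l : letter) : letter := (l.1, ~~ l.2).

Definition reduced (w : seq letter) : bool :=
  sorted (fun l m => m != letter_inv l) w.

Record free_group := FreeGroup {
  word_of :> seq letter;
  word_of_reduced : reduced word_of
}.

HB.instance Definition _ := [isSub for word_of].
HB.instance Definition _ := [Choice of free_group by <:].

Definition letter_act (l : letter) (w : seq letter) : seq letter :=
  if w is m :: w' then if m == letter_inv l then w' else l :: w else [:: l].

(* The reduced form of the concatenation u ++ v, when v is reduced.           *)
Definition word_mul (u v : seq letter) : seq letter := foldr letter_act v u.

Definition word_inv (w : seq letter) : seq letter := rev (map letter_inv w).

Lemma letter_invK : involutive letter_inv.
Proof. by case=> a b; rewrite /letter_inv negbK. Qed.

Lemma letter_act_reduced l w : reduced w -> reduced (letter_act l w).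
Proof.
case: w => [|m w] //= mw; case: ifP => [_|ml]; first exact: path_sorted mw.
by rewrite /reduced /= ml.
Qed.

Lemma word_mul_reduced u v : reduced v -> reduced (word_mul u v).
Proof. by move=> rv; elim: u => //= l u; apply: letter_act_reduced. Qed.

Lemma letter_actK l w :
  reduced w -> letter_act l (letter_act (letter_inv l) w) = w.
Proof.
case: w => [|m w] /=; first by rewrite eqxx.
rewrite letter_invK; case: eqP => [->|_] /=; last by rewrite eqxx.
case: w => [|p w] //= /andP[]; by case: eqP.
Qed.

Lemma word_mul_act l v w :
  reduced w -> word_mul (letter_act l v) w = letter_act l (word_mul v w).
Proof.
move=> rw; case: v => [|m v] //=; case: eqP => [->|//].
by rewrite letter_actK // word_mul_reduced.
Qed.

Lemma word_mulA u v w : reduced w ->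
  word_mul u (word_mul v w) = word_mul (word_mul u v) w.
Proof.
by move=> rw; elim: u => //= l u IHu; rewrite word_mul_act // -IHu.
Qed.

Lemma word_mul1 u : reduced u -> word_mul u [::] = u.
Proof.
elim: u => //= l u IHu ru; rewrite IHu; last exact: path_sorted ru.
by case: u ru {IHu} => //= m u /andP[/negPf->].
Qed.

Lemma word_inv_reduced u : reduced u -> reduced (word_inv u).
Proof.
rewrite /reduced /word_inv rev_sorted sorted_map.
apply: sub_sorted => l m /=.
by apply: contra => /eqP->; rewrite !letter_invK.
Qed.

Lemma word_mulV u v : reduced v -> word_mul (word_inv u) (word_mul u v) = v.
Proof.
move=> rv; elim: u => //= l u IHu.
rewrite /word_inv /= rev_cons /word_mul foldr_rcons.
rewrite -[foldr _ _ (rev _)]/(word_mul (word_inv u) _) -[X in _ = X]IHu.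
congr word_mul; rewrite -{2}(letter_invK l) letter_actK //.
exact: word_mul_reduced.
Qed.

Definition free_mul (u v : free_group) : free_group :=
  FreeGroup (word_mul_reduced u (word_of_reduced v)).

Definition free_one : free_group := @FreeGroup [::] isT.

Definition free_inv (u : free_group) : free_group :=
  FreeGroup (word_inv_reduced (word_of_reduced u)).

Lemma free_mulA : associative free_mul.
Proof.
by move=> u v w; apply: val_inj; apply: word_mulA; apply: word_of_reduced.
Qed.

Lemma free_mul1g : left_id free_one free_mul.
Proof. by move=> u; apply: val_inj. Qed.

Lemma free_mulg1 : right_id free_one free_mul.
Proof. by move=> u; apply: val_inj; apply: word_mul1; apply: word_of_reduced. Qed.

Lemma free_mulVg : left_inverse free_one free_inv free_mul.
Proof.
move=> u; apply: val_inj; have := word_mulV u (isT : reduced [::]).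
by rewrite word_mul1 //; apply: word_of_reduced.
Qed.

Lemma free_mulgV : right_inverse free_one free_inv free_mul.
Proof.
move=> u; rewrite -[LHS]free_mul1g -{1}(free_mulVg (free_inv u)) -free_mulA.
by rewrite (free_mulA (free_inv u)) free_mulVg free_mul1g free_mulVg.
Qed.

HB.instance Definition _ := isGroup.Build free_group
  free_mulA free_mul1g free_mulg1 free_mulVg free_mulgV.

End FreeGroup.

Fixpoint primitive_rec n (f : n.-tuple nat -> nat) (g : n.+2.-tuple nat -> nat)
    (m : nat) (v : n.-tuple nat) : nat :=
  if m is m'.+1
  then g [tuple of m' :: primitive_rec f g m' v :: v]
  else f v.

(* The total recursive functions on nat: minimisation is applied only to      *)
(* regular functions, so that no partial function is needed.                  *)
Inductive recursive : forall n, (n.-tuple nat -> nat) -> Prop :=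
| recursive_zero n : recursive (fun _ : n.-tuple nat => 0)
| recursive_succ : recursive (fun v : 1.-tuple nat => (thead v).+1)
| recursive_proj n (i : 'I_n) : recursive (fun v : n.-tuple nat => tnth v i)
| recursive_comp m n (f : m.-tuple nat -> nat)
    (g : 'I_m -> n.-tuple nat -> nat) :
    recursive f -> (forall i, recursive (g i)) ->
    recursive (fun v : n.-tuple nat => f [tuple g i v | i < m])
| recursive_prim n (f : n.-tuple nat -> nat) (g : n.+2.-tuple nat -> nat) :
    recursive f -> recursive g ->
    recursive (fun v : n.+1.-tuple nat =>
                 primitive_rec f g (thead v) [tuple of behead v])
| recursive_min n (f : n.+1.-tuple nat -> nat)
    (f0 : forall v : n.-tuple nat, exists m, f [tuple of m :: v] == 0) :
    recursive f ->
    recursive (fun v : n.-tuple nat => ex_minn (f0 v)).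

Definition recursive_set (d : pred nat) : Prop :=
  recursive (fun v : 1.-tuple nat => nat_of_bool (d (thead v))).

Section Decidability.
Variable A : choiceType.

Definition letter_code (enc : A -> nat) (l : letter A) : nat :=
  ((enc l.1).*2 + l.2)%N.

(* CodeSeq.code [:: n1; ...; nr] is the integer whose binary expansion is     *)
(* 1 0^nr ... 1 0^n1.                                                         *)
Definition word_code (enc : A -> nat) (w : seq (letter A)) : nat :=
  CodeSeq.code (map (letter_code enc) w).

Definition generators_code (enc : A -> nat) (s : seq (free_group A)) : nat :=
  CodeSeq.code (map (fun u => word_code enc (word_of u)) s).

(* Inputs are finite words, so the letters must be named by integers. When A  *)
(* is countable one may take B = setT; restricting to a set B of named        *)
(* letters makes sense of the notion for uncountable A too.                   *)
Definition decidable_fg (P : set (free_group A) -> Prop) : Prop :=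
  forall (B : set A) (enc : A -> nat), {in B &, injective enc} ->
  exists2 d : pred nat, recursive_set d &
    forall s : seq (free_group A),
      (forall u l, u \in s -> l \in word_of u -> B l.1) ->
      d (generators_code enc s) <-> P (generated [set` s]).

End Decidability.

(* Main.v *)
From HB Require Import structures.
Require Import Defs.
From mathcomp Require Import all_boot all_fingroup commutator.
From mathcomp Require Import boolp classical_sets functions cardinality filter.
From mathcomp Require Import topology.
From mathcomp Require Import finmap zify.
Import Defs.

(** The theorem reduces to one fact about a free group F of rank at least two: a
    finitely generated subgroup K containing the k-th derived subgroup F^(k) has
    finite index, and the prefixes of its generators represent all its right
    cosets ([covered_all]). Indeed, when a product of generators of K is read
    letter by letter, only cosets of such prefixes are met ([covered_prefix]);
    on the other hand F^(k) is normal and, in rank at least two, contains some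
    n <> 1 ([comm_values_neq1]), and for every g in F a suitable letter z makes
    g a prefix of the reduced word of g z n z^-1 g^-1, an element of K
    ([free_take_conj]).

    The closure Cl of H is a subgroup containing F^(k), since every homomorphism
    to a k-solvable group kills F^(k); this is (i). If Cl is finitely generated,
    the fact above applies to it, so Cl has finite index; and every letter occurs
    in its generators, because a letter outside them lies in no coset of a
    prefix ([not_covered_letter]). This gives (ii) and one half of (iii), whose
    other half is Schreier's theorem ([finite_index_fg]). In rank one the group
    is infinite cyclic, where every subgroup but the trivial one has finite index.

    For (iv), in rank at least two H is closed exactly when it contains F^(k).
    If it does, the action of F on the finitely many cosets of H kills F^(k), so
    its image is a finite k-solvable group, and it separates H, the stabilizer of
    a point, from any other element. When A is infinite, or not all its letters are named, this never
    happens, and in rank at most one H is always closed because F is abelian and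
    finitely generated subgroups are separable. There remains the inclusion of
    F^(k) in H for a finite alphabet. If it fails, some value of the k-fold
    iterated commutator lies outside H, and M. Hall's completion of a finite part
    of the Schreier graph of H to a permutation representation
    ([coset_representation]) yields points permuted by F, one of which is fixed
    by H but not by F^(k). The number of points is bounded linearly in the
    length of the input ([moving_representation]): either the prefixes represent
    all cosets, and the representation is the action on them, or else a conjugate
    of n by a word two letters longer than a prefix is already outside H.
    So inclusion can be tested by running through all the permutation
    representations of bounded degree and, in each, all the values of the
    iterated commutator ([decide]); every element of a permutation group of
    degree d is represented by a word of length at most d! ([short_word]), so
    that all the searches are bounded ([rec_decide]). *)

Set Implicit Arguments.
Unset Strict Implicit.
Unset Printing Implicit Defensive.

Local Open Scope classical_set_scope.
Local Open Scope group_scope.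

(** * Subgroups and iterated commutators *)

Section GroupTheory.
Variable G : groupType.
Implicit Types (H K N S : set G) (x y z : G).

Lemma subgroupV H x : is_subgroup H -> H x -> H x^-1.
Proof. by move=> [H1 HB] Hx; rewrite -[x^-1]mul1g; apply: HB. Qed.

Lemma subgroupM H x y : is_subgroup H -> H x -> H y -> H (x * y).
Proof.
by move=> sH Hx Hy; rewrite -[y]invgK; apply: sH.2 => //; apply: subgroupV.
Qed.

Lemma sub_generated S : S `<=` generated S.
Proof. exact: sub_smallest. Qed.

Lemma generated_min S K : is_subgroup K -> S `<=` K -> generated S `<=` K.
Proof. by move=> sK SK x; apply. Qed.

Lemma generated_subgroup S : is_subgroup (generated S).
Proof.
split=> [K [sK _]|x y Sx Sy K sK]; first exact: sK.1.
by apply: sK.1.2; [apply: Sx|apply: Sy].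
Qed.

(** In place of the derived subgroup $G^{(k)}$ one can work with the explicit
    set of values of the iterated commutator word of depth [k]: it is stable
    under conjugation, and it generates $G^{(k)}$. *)
Fixpoint comm_values (k : nat) : set G :=
  if k is j.+1 then [set [~ x, y] | x in comm_values j & y in comm_values j]
  else setT.

Lemma comm_valuesJ k x z : comm_values k x -> comm_values k (x ^ z).
Proof.
elim: k x => //= k IHk _ [x kx [y ky <-]].
by rewrite conjRg; exists (x ^ z); [apply: IHk | exists (y ^ z) => //; apply: IHk].
Qed.

Lemma derived_subgroupS k :
  derived_subgroup G k.+1 =
  commutator_subgroup (derived_subgroup G k) (derived_subgroup G k).
Proof. by []. Qed.

Lemma derived_subgroup_subgroup k : is_subgroup (derived_subgroup G k).
Proof. by case: k => [|k]; [split | apply: generated_subgroup]. Qed.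

Lemma comm_values_derived k : comm_values k `<=` derived_subgroup G k.
Proof.
elim: k => //= k IHk _ [x kx [y ky <-]].
by apply: sub_generated; exists x; [apply: IHk | exists y => //; apply: IHk].
Qed.

Lemma commMg x y z : [~ x * y, z] = [~ x, z] ^ y * [~ y, z].
Proof.
by rewrite !commgEl !conjgE !invgM !mulgA -!mulgA !mulVKg !mulgA.
Qed.

Lemma commVg x y : [~ x^-1, y] = [~ x, y]^-1 ^ x^-1.
Proof.
have /eqP := comm1g y; rewrite -{1}(mulgV x) commMg mulg_eq1 => /eqP.
by rewrite conjVg => ->; rewrite invgK.
Qed.

(** The elements commuting modulo a normal subgroup with a given element form
    a subgroup; so commutators of a generating set control all commutators. *)
Lemma commutator_generated S N : is_subgroup N ->
  (forall x z, N x -> N (x ^ z)) ->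
  (forall x y, S x -> S y -> N [~ x, y]) ->
  commutator_subgroup (generated S) (generated S) `<=` N.
Proof.
move=> sN nN SN.
have sC y : is_subgroup [set x | N [~ x, y]].
  split=> /= [|x z Nx Nz]; first by rewrite comm1g; apply: sN.1.
  rewrite commMg; apply: subgroupM => //; first exact: nN.
  by rewrite commVg; apply: nN; apply: subgroupV.
apply: generated_min => // _ [x Sx [y Sy <-]].
have {}Sx : forall z, S z -> N [~ z, x].
  move=> z Sz; rewrite -invgR; apply: subgroupV => //.
  by apply: (Sx [set x | N [~ x, z]]); split => // u Su; apply: SN.
rewrite -invgR; apply: subgroupV => //.
by apply: (Sy [set y | N [~ y, x]]); split.
Qed.

Lemma derived_generated k : derived_subgroup G k `<=` generated (comm_values k).
Proof.
elim: k => [|k IHk]; first by move=> x _; apply: sub_generated.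
rewrite derived_subgroupS.
apply: (@subset_trans _ (commutator_subgroup
    (generated (comm_values k)) (generated (comm_values k)))).
  apply: generated_min => [|_ [x kx [y ky <-]]]; first exact: generated_subgroup.
  by apply: sub_generated; exists x; [apply: IHk | exists y => //; apply: IHk].
apply: commutator_generated => [|x z|x y kx ky].
- exact: generated_subgroup.
- move=> Nx; pose K := [set x | generated (comm_values k.+1) (x ^ z)].
  apply: (Nx K); split=> [|{Nx}x kx].
    have sN := generated_subgroup (comm_values k.+1).
    split=> [|a b]; first by rewrite /K /= conj1g; apply: sN.1.
    by rewrite /K /= conjMg conjVg; apply: sN.2.
  by apply: sub_generated; apply: comm_valuesJ.
- by apply: sub_generated; exists x => //; exists y.
Qed.

Lemma derived_sub k H : is_subgroup H ->
  (derived_subgroup G k `<=` H) <-> (comm_values k `<=` H).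
Proof.
move=> sH; split=> [|kH]; first exact: (subset_trans (@comm_values_derived k)).
by apply: subset_trans (@derived_generated k) _; apply: generated_min.
Qed.

Lemma derivedJ k x z : derived_subgroup G k x -> derived_subgroup G k (x ^ z).
Proof.
have sD := derived_subgroup_subgroup k.
suff: derived_subgroup G k `<=` [set x | derived_subgroup G k (x ^ z)] by apply.
apply/derived_sub => [|y ky].
  split=> [|a b]; first by rewrite /= conj1g; apply: sD.1.
  by rewrite /= conjMg conjVg; apply: sD.2.
by apply: comm_values_derived; apply: comm_valuesJ.
Qed.

Lemma finite_indexP H : is_subgroup H ->
  (exists xs : seq G, forall g, exists2 x, x \in xs & H (g * x^-1)) <->
  finite_index H.
Proof.
move=> sH; split=> [[xs Hxs]|].
  apply: (@sub_finite_set _ _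
    ((fun x => [set h * x | h in H]) @` [set` xs])); last exact: finite_image.
  move=> _ [g _ <-]; have [x xxs Hgx] := Hxs g; exists x => //.
  apply/seteqP; split=> _ [h Hh <-].
    exists (h * (g * x^-1)^-1); first by apply: sH.2.
    by rewrite invgM invgK !mulgA mulgVK.
  exists (h * (g * x^-1)); first by apply: subgroupM.
  by rewrite mulgA mulgVK.
case/finite_seqP => Cs HCs.
have rep C : exists x, coset_set H C -> C = [set h * x | h in H].
  by have [[x _ <-]|nC] := pselect (coset_set H C); [exists x | exists 1].
pose r C := projT1 (cid (rep C)).
exists (map r Cs) => g; pose C := [set h * g | h in H].
have CH : coset_set H C by exists g.
exists (r C); first by apply: map_f; rewrite HCs in CH.
have: [set h * r C | h in H] g.
  have <- : C = [set h * r C | h in H] by rewrite /r; case: cid => x /= /(_ CH).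
  by exists 1; rewrite ?mul1g //; apply: sH.1.
by case=> h Hh <-; rewrite mulgK.
Qed.

End GroupTheory.

Section Multiplicative.
Variables (G R : groupType) (f : {multiplicative G -> R}).

Lemma multiplicative1 : f 1 = 1.
Proof. by apply: (mulgI (f 1)); rewrite -gmulfM !mulg1. Qed.

Lemma multiplicativeV : {morph f : x / x^-1}.
Proof.
by move=> x; apply/esym/mulg1_eq; rewrite -gmulfM mulgV multiplicative1.
Qed.

Lemma multiplicativeR : {morph f : x y / [~ x, y]}.
Proof. by move=> x y; rewrite !commgEl !conjgE !gmulfM !multiplicativeV. Qed.

End Multiplicative.

Lemma comm_values_image (G R : groupType) (f : {multiplicative G -> R}) k x :
  comm_values k x -> comm_values k (f x).
Proof.
elim: k x => //= k IHk _ [x kx [y ky <-]].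
by exists (f x); [apply: IHk | exists (f y); [apply: IHk | rewrite multiplicativeR]].
Qed.

(** Membership in the pseudovariety is a statement about the derived series of
    a finite group, whereas homomorphisms transport commutator values. *)
Lemma derg_derived (gT : finGroupType) k :
  [set` [set: gT]%SET^`(k)] = derived_subgroup gT k.
Proof.
elim: k => [|k IHk]; first by apply/seteqP; split=> x //= _; rewrite finset.in_setT.
rewrite derived_subgroupS -IHk dergSn; apply/seteqP; split.
  move=> x /= Dx K [sK KS].
  pose KG := [set y | `[< K y >]]%SET.
  have gK : group_set KG.
    apply/group_setP; split=> [|y z]; rewrite !inE; first by apply/asboolP/sK.1.
    move=> /asboolP Ky /asboolP Kz; apply/asboolP.
    exact: (subgroupM sK).
  have: commutator [set: gT]%SET^`(k) [set: gT]%SET^`(k) \subset Group gK.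
    rewrite gen_subG; apply/fintype.subsetP => _ /imset2P[y z Dy Dz ->].
    by rewrite inE; apply/asboolP/KS; exists y => //; exists z.
  by move/fintype.subsetP/(_ x Dx); rewrite inE => /asboolP.
apply: generated_min => [|_ [y Dy [z Dz <-]] /=]; last exact: mem_commg.
split=> /= [|y z]; first exact: group1.
by move=> Dy Dz; rewrite groupM ?groupV.
Qed.

Lemma k_solvableP k (gT : finGroupType) :
  k_solvable k gT <-> (comm_values k `<=` [set 1 : gT]).
Proof.
have s1 : is_subgroup [set 1 : gT].
  by split=> // x y /= -> ->; rewrite invg1 mulg1.
rewrite -derived_sub // -derg_derived /k_solvable; split=> [-> x|D1].
  by rewrite /= inE => /eqP.
apply/trivgP/fintype.subsetP => x Dx; rewrite inE; apply/eqP.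
exact: (D1 x Dx).
Qed.

(** * The pro-V closure *)

Section Closure.
Variables (V : pseudovariety) (G : groupType).

(** Finitely many continuity constraints can be merged into a single
    homomorphism, since pseudovarieties are closed under products; so the fibres
    of single homomorphisms form a base of the topology. *)
Lemma merge_pro_subbase (s : seq (set G)) x :
  (forall U, U \in s -> pro_subbase V U) -> (forall U, U \in s -> U x) ->
  exists gT : finGroupType, exists2 f : {multiplicative G -> gT},
    V gT & forall y, f y = f x -> forall U, U \in s -> U y.
Proof.
elim: s => [|W s IHs] Ws Wx.
  have f1M : {morph (fun _ : G => 1 : {perm 'I_0}) : y z / y * z}.
    by move=> y z; rewrite mulg1.
  pose f1 : {multiplicative G -> {perm 'I_0}} :=
    HB.pack (fun _ : G => 1 : {perm 'I_0}) (isMultiplicative.Build _ _ _ f1M).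
  by exists {perm 'I_0}, f1 => //; apply: pv_trivial; rewrite card_Sn.
have [W' W's|W' W's|gT [f VgT fs]] := IHs.
- by apply: Ws; rewrite inE W's orbT.
- by apply: Wx; rewrite inE W's orbT.
have [|hT [g [Y [VhT WE]]]] := Ws W; first by rewrite inE eqxx.
have pM : {morph (fun y : G => (f y, g y) : (gT * hT)%type) : y z / y * z}.
  by move=> y z; rewrite !gmulfM.
pose p : {multiplicative G -> (gT * hT)%type} :=
  HB.pack (fun y : G => (f y, g y)) (isMultiplicative.Build _ _ _ pM).
exists (gT * hT)%type, p => [|y [fy gy] W']; first exact: pv_product.
rewrite inE => /orP[/eqP ->|]; last exact: fs.
have := Wx W; rewrite inE eqxx WE /= => /(_ isT).
by rewrite /preimage /= gy.
Qed.

Lemma pro_closureP (H : set G) x : is_subgroup H ->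
  pro_closure V H x <->
  forall (gT : finGroupType) (f : {multiplicative G -> gT}), V gT ->
    exists2 h, H h & f h = f x.
Proof.
move=> sH; split=> [Hx gT f VgT|Hx U].
  have: nbhs (x : pro V G) (f @^-1` [set f x]).
    apply: open_nbhs_nbhs; split=> //.
    exists [set (f @^-1` [set f x] : set G)]; last by rewrite bigcup_set1.
    move=> _ ->; apply: (@finI_from1 (set G) _ _ id).
    by exists gT, f, [set f x].
  by move/Hx => [h [Hh fh]]; exists h.
rewrite nbhsE => -[O [[B BI <-] [C BC Cx]] OU].
have [F Fsub FC] := BI C BC.
have [W /Fsub/set_mem//|W WF|gT [f VgT fC]] := @merge_pro_subbase (enum_fset F) x.
  by move: Cx; rewrite -FC; apply.
have [h Hh fh] := Hx gT f VgT.
exists h; split=> //; apply: OU; exists C; first by [].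
suff: C h by [].
rewrite -FC => W /= WF.
exact: (fC h fh W WF).
Qed.

Lemma pro_closure_subgroup (H : set G) :
  is_subgroup H -> is_subgroup (pro_closure V H).
Proof.
move=> sH; split=> [|x y /pro_closureP Hx /pro_closureP Hy].
  by apply/pro_closureP => // gT f _; exists 1 => //; apply: sH.1.
apply/pro_closureP => // gT f VgT.
have [[h Hh fh] [h' Hh' fh']] := (Hx sH gT f VgT, Hy sH gT f VgT).
by exists (h * h'^-1); [apply: sH.2 | rewrite !gmulfM !multiplicativeV fh fh'].
Qed.

Lemma sub_pro_closure (H : set G) : H `<=` pro_closure V H.
Proof. exact: (@subset_closure (pro V G) H). Qed.

End Closure.

Section SolvableClosure.
Variables (k : nat) (G : groupType).

Lemma derived_sub_closure (H : set G) : is_subgroup H ->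
  derived_subgroup G k `<=` pro_closure (finite_solvable k) H.
Proof.
move=> sH; apply/derived_sub => [|x kx]; first exact: pro_closure_subgroup.
apply/pro_closureP => // gT f /k_solvableP gTk.
exists 1; first exact: sH.1.
by rewrite multiplicative1; apply/esym/gTk/comm_values_image.
Qed.

(** A finite permutation representation killing $G^{(k)}$ has k-solvable image,
    so it separates an element from a subgroup as soon as some point is fixed
    by the subgroup but not by the element. *)
Lemma notin_pro_closure (T : finType) (f : {multiplicative G -> {perm T}})
    (H : set G) x t : is_subgroup H ->
  (forall y, derived_subgroup G k y -> f y = 1) ->
  (forall h, H h -> f h t = t) -> f x t != t ->
  ~ pro_closure (finite_solvable k) H x.
Proof.
move=> sH fk Ht xt /pro_closureP => /(_ sH) Hx.
pose D := [set p | `[< exists y, p = f y >]]%SET.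
have gD : group_set D.
  apply/group_setP; split=> [|p q]; rewrite !inE.
    by apply/asboolP; exists 1; rewrite multiplicative1.
  move=> /asboolP[y ->] /asboolP[z ->]; apply/asboolP.
  by exists (y * z); rewrite gmulfM.
have fD y : f y \in Group gD by rewrite inE; apply/asboolP; exists y.
have fsM : {morph (fun y : G => subg (Group gD) (f y)) : y z / y * z}.
  by move=> y z; rewrite -(morphM (subg_morphism _)) ?gmulfM.
pose fs : {multiplicative G -> subg_of (Group gD)} :=
  HB.pack (fun y : G => subg (Group gD) (f y)) (isMultiplicative.Build _ _ _ fsM).
have lift j (p : subg_of (Group gD)) :
    comm_values j p -> exists2 y, comm_values j y & p = fs y.
  elim: j p => [|j IHj] p /=.
    have := valP p; rewrite inE => /asboolP[y py]; exists y => //.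
    by apply: val_inj; rewrite /= subgK.
  case=> q /IHj[y jy ->] [r /IHj[z jz ->] <-].
  exists [~ y, z]; first by exists y => //; exists z.
  exact: (esym (multiplicativeR fs y z)).
have [|h Hh fh] := Hx _ fs.
  apply/k_solvableP => _ /lift[y ky ->] /=; rewrite fk.
    by apply: val_inj; rewrite /= subgK.
  exact: comm_values_derived.
move: xt; have := congr1 val fh; rewrite /= !subgK // => <-.
by rewrite Ht ?eqxx.
Qed.

End SolvableClosure.

(** * Words in free groups *)

Section FreeGroup.
Variable A : choiceType.
Notation F := (free_group A).
Implicit Types (g h x : F) (l m z : letter A) (u v w : seq (letter A)) (s : seq F).

Definition of_letter l : F := @FreeGroup A [:: l] isT.

Lemma free_inj g h : word_of g = word_of h -> g = h.
Proof. exact: val_inj. Qed.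

Lemma of_letterV l : (of_letter l)^-1 = of_letter (letter_inv l).
Proof. exact: free_inj. Qed.

Lemma word_mul_cat u v : reduced (u ++ v) -> word_mul u v = u ++ v.
Proof.
elim: u => //= l u IHu ruv; rewrite IHu; last exact: path_sorted ruv.
by case: (u ++ v) ruv => //= m w /andP[/negPf ->].
Qed.

Lemma word_of_mul g h :
  reduced (word_of g ++ word_of h) -> word_of (g * h) = word_of g ++ word_of h.
Proof. exact: word_mul_cat. Qed.

Lemma reduced_take n w : reduced w -> reduced (take n w).
Proof. by move=> rw; apply: take_sorted. Qed.

(** Two reduced words overlapping in a letter can be glued along it. *)
Lemma reduced_glue u l v :
  reduced (u ++ l :: v) = reduced (rcons u l) && reduced (l :: v).
Proof.
case: u => [|m u] //=; rewrite /reduced /= cat_path rcons_path /=.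
by rewrite andbA.
Qed.

Definition free_take n g : F :=
  FreeGroup (reduced_take n (word_of_reduced g)).

Lemma word_of_take n g : word_of (free_take n g) = take n (word_of g).
Proof. by []. Qed.

Lemma free_take_ge n g : (size (word_of g) <= n)%N -> free_take n g = g.
Proof. by move=> gn; apply: free_inj; rewrite /= take_oversize. Qed.

Lemma free_take0 g : free_take 0 g = 1.
Proof. by apply: free_inj; rewrite /= take0. Qed.

Lemma free_takeS n g : (n < size (word_of g))%N ->
  exists l, free_take n.+1 g = free_take n g * of_letter l.
Proof.
move=> ng; case Eg: (drop n (word_of g)) => [|l v].
  by move/(congr1 size)/eqP: Eg; rewrite size_drop /= subn_eq0 leqNgt ng.
have Et : take n.+1 (word_of g) = take n (word_of g) ++ [:: l].
  rewrite -addn1 takeD Eg /=; by rewrite take0.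
exists l; apply: free_inj; rewrite word_of_mul /= ?Et //.
by rewrite -Et; apply: reduced_take; apply: word_of_reduced.
Qed.

Lemma free_ind (P : F -> Prop) : P 1 ->
  (forall g l, P g -> P (g * of_letter l)) -> forall g, P g.
Proof.
move=> P1 PM g; suff Pn n : (n <= size (word_of g))%N -> P (free_take n g).
  by have := Pn _ (leqnn _); rewrite free_take_ge.
elim: n => [|n IHn] ng; first by rewrite free_take0.
by have [l ->] := free_takeS ng; apply: PM; apply: IHn; apply: ltnW.
Qed.

Lemma word_of_mul_letter g l :
  word_of (g * of_letter l) = rcons (word_of g) l \/
  word_of g = rcons (word_of (g * of_letter l)) (letter_inv l).
Proof.
have [rgl|rgl] := boolP (reduced (rcons (word_of g) l)).
  by left; rewrite -cats1 word_of_mul //= cats1.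
have [w [m Eg]] : exists w m, word_of g = rcons w m.
  by case/lastP: (word_of g) rgl => // w m; exists w, m.
have rwm : reduced (rcons w m) by rewrite -Eg word_of_reduced.
have /eqP lm : l == letter_inv m.
  move: rgl; apply: contraR => lm.
  by rewrite Eg -cats1 cat_rcons reduced_glue rwm /reduced /= lm.
have rw : reduced w by move: rwm; rewrite -cats1 => /cat_sorted2[].
have Egw : g = FreeGroup rw * of_letter m.
  by apply: free_inj; rewrite word_of_mul /= cats1.
have -> : g * of_letter l = FreeGroup rw.
  by rewrite Egw lm -of_letterV mulgK.
by right; rewrite Eg lm letter_invK.
Qed.

Section Prefixes.
Variable Q : set F.

Let prefix_in g := forall n, Q (free_take n g).

Lemma prefix_in_mul_letter g l :
  prefix_in g -> Q (g * of_letter l) -> prefix_in (g * of_letter l).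
Proof.
move=> Qg Qgl n; have [|ngl] := leqP (size (word_of (g * of_letter l))) n.
  by move/free_take_ge ->.
suff -> : free_take n (g * of_letter l) = free_take n g by [].
apply: free_inj; rewrite !word_of_take.
case: (word_of_mul_letter g l) ngl => E ngl.
  by rewrite E; move: ngl; rewrite E size_rcons ltnS -cats1 => /takel_cat ->.
by rewrite E -cats1 takel_cat // ltnW.
Qed.

End Prefixes.

(** ** The Schreier graph of a finitely generated subgroup *)

(** The leading 1 selects the base vertex even when there are no generators. *)
Definition prefixes s : seq F :=
  1 :: flatten [seq [seq free_take n g | n <- iota 0 (size (word_of g)).+1] | g <- s].

Lemma mem_prefixes s g n : g \in s -> free_take n g \in prefixes s.
Proof.
move=> gs; rewrite inE; apply/orP; right; apply/flatten_mapP; exists g => //.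
apply/mapP; exists (minn n (size (word_of g))).
  by rewrite mem_iota leq0n add0n ltnS geq_minr.
by apply: free_inj; rewrite !word_of_take take_min take_size.
Qed.

Lemma prefixesP s p : p \in prefixes s ->
  p = 1 \/ exists2 g, g \in s & exists n, p = free_take n g.
Proof.
rewrite inE => /orP[/eqP|/flatten_mapP[g gs /mapP[n _ ->]]]; [by left | right].
by exists g => //; exists n.
Qed.

(** In the Schreier graph of [H], with the right cosets as vertices, the
    elements [xs] select finitely many vertices; these are the words leading
    from the base vertex to a selected one. *)
Definition covered (H : set F) (xs : seq F) : set F :=
  [set g | exists2 x, x \in xs & H (g * x^-1)].

Section Covered.
Variables (H : set F) (xs : seq F).
Hypothesis sH : is_subgroup H.

Lemma covered_mem x : x \in xs -> covered H xs x.
Proof. by move=> xxs; exists x => //; rewrite mulgV; apply: sH.1. Qed.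

Lemma coveredM h g : H h -> covered H xs g -> covered H xs (h * g).
Proof.
move=> Hh [x xxs Hgx]; exists x => //.
by rewrite -mulgA; apply: subgroupM.
Qed.

End Covered.

(** Reading a product of generators and their inverses letter by letter, all
    the intermediate elements lie in cosets of prefixes of generators; and
    cancelling letters only discards intermediate elements. *)
Lemma covered_prefix (H : set F) s h n : H = generated [set` s] -> H h ->
  covered H (prefixes s) (free_take n h).
Proof.
move=> HE; have sH : is_subgroup H by rewrite HE; apply: generated_subgroup.
set Q := covered _ _; pose C g := forall n, Q (free_take n g).
have QM (g p : F) : H g -> p \in prefixes s -> Q (g * p).
  by move=> Hg ps; apply: coveredM => //; apply: covered_mem.
have Hs x : x \in s -> H x by move=> xs; rewrite HE; apply: sub_generated.
have CM x g : x \in s -> H g -> C g -> C (g * x).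
  move=> xs Hg Cg; suff Ci i : (i <= size (word_of x))%N -> C (g * free_take i x).
    by have := Ci _ (leqnn _); rewrite free_take_ge.
  elim: i => [|i IHi] ix; first by rewrite free_take0 mulg1.
  have [l El] := free_takeS ix; rewrite El mulgA.
  apply: prefix_in_mul_letter; first by apply: IHi; apply: ltnW.
  by rewrite -mulgA -El; apply: QM => //; apply: mem_prefixes.
have CV x g : x \in s -> H g -> C g -> C (g * x^-1).
  move=> xs Hg Cg; have Hgx : H (g * x^-1) by apply: sH.2 => //; apply: Hs.
  suff Ci i : (i <= size (word_of x))%N ->
      C (g * x^-1 * free_take (size (word_of x) - i) x).
    by have := Ci _ (leqnn _); rewrite subnn free_take0 mulg1.
  elim: i => [|i IHi] ix; first by rewrite subn0 free_take_ge // mulgVK.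
  have [|l] := @free_takeS (size (word_of x) - i.+1) x.
    by rewrite ltn_subrL /=; apply: leq_ltn_trans ix.
  rewrite subnSK // => El.
  have {}El : free_take (size (word_of x) - i.+1) x =
      free_take (size (word_of x) - i) x * of_letter (letter_inv l).
    by rewrite El -of_letterV mulgK.
  rewrite El mulgA.
  apply: prefix_in_mul_letter; first by apply: IHi; apply: ltnW.
  by rewrite -mulgA -El; apply: QM => //; apply: mem_prefixes.
pose K := [set x | H x /\ forall g, H g -> C g -> C (g * x) /\ C (g * x^-1)].
have sK : is_subgroup K.
  split=> [|x y [Hx Kx] [Hy Ky]].
    by split=> [|g Hg Cg]; [apply: sH.1 | rewrite invg1 mulg1].
  split=> [|g Hg Cg]; first exact: sH.2.
  rewrite invgF !mulgA; have [Cx Cxv] := Kx _ Hg Cg; have [Cy Cyv] := Ky _ Hg Cg.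
  by split; [apply: (Ky _ _ _).2 | apply: (Kx _ _ _).2] => //; apply: subgroupM.
move=> Hh; have : K h.
  rewrite HE in Hh; apply: Hh; split=> // x /= xs; split=> [|g Hg Cg].
    exact: Hs.
  by split; [apply: CM | apply: CV].
case=> _ /(_ 1 sH.1)[].
  by move=> i; apply: covered_mem.
by rewrite mul1g => + _; apply.
Qed.

(** The words avoiding a letter form a subgroup stable under prefixes, and it
    contains the generators. *)
Lemma not_covered_letter (H : set F) s a : H = generated [set` s] ->
  (forall g l, g \in s -> l \in word_of g -> l.1 != a) ->
  ~ covered H (prefixes s) (of_letter (a, true)).
Proof.
move=> HE sa; pose N := [set g : F | forall l, l \in word_of g -> l.1 != a].
have sN : is_subgroup N.
  split=> // g h Ng Nh.
  have {Nh} : forall l, l \in word_of h^-1 -> l.1 != a.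
    move=> l; rewrite /= mem_rev => /mapP[m mh ->].
    exact: (Nh m mh).
  have {}Ng : forall l, l \in word_of g -> l.1 != a by [].
  move=> Nh; suff: forall l, l \in word_mul (word_of g) (word_of h^-1) -> l.1 != a by [].
  move: (word_of h^-1) Nh => v Nv.
  elim: (word_of g) Ng => //= m w IHw Nw.
  have {}IHw : forall l, l \in word_mul w v -> l.1 != a.
    by apply: IHw => l lw; apply: Nw; rewrite inE lw orbT.
  case: (word_mul w v) IHw => [|p q] IHw l /=.
    by rewrite inE => /eqP ->; apply: Nw; rewrite mem_head.
  case: ifP => _ lq; first by apply: IHw; rewrite inE lq orbT.
  move: lq; rewrite inE => /orP[/eqP ->|]; last exact: IHw.
  by apply: Nw; rewrite mem_head.
have Ns : [set` s] `<=` N by move=> g /= gs l; apply: sa.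
case=> p ps; rewrite HE => /(generated_min sN Ns) Np.
have Npp : N p.
  case: (prefixesP ps) => [->//|[g gs [n ->]] l /= /mem_take]; exact: sa.
have := subgroupM sN Np Npp; rewrite mulgVK => /(_ (a, true)).
by rewrite inE eqxx => /(_ isT); rewrite eqxx.
Qed.

End FreeGroup.

(** ** Normal subgroups and conjugates without cancellation *)

Section Conjugates.
Variable A : choiceType.
Notation F := (free_group A).
Implicit Types (g h x : F) (l m z : letter A) (s : seq F).

Definition conj_letter z g : F := g ^ (of_letter z)^-1.

Lemma word_of_conj_letter d z g : g != 1 ->
  z != letter_inv (head d (word_of g)) -> z != last d (word_of g) ->
  word_of (conj_letter z g) = z :: rcons (word_of g) (letter_inv z).
Proof.
move=> g1 zg gz.
have rzg : reduced (z :: rcons (word_of g) (letter_inv z)).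
  case Eg: (word_of g) (word_of_reduced g) g1 zg gz => [|l w].
    by move=> _ /eqP[]; apply: free_inj.
  rewrite /reduced /= rcons_path => -> _ zl zw.
  rewrite andTb; apply/andP; split.
    by apply: contra zl => /eqP ->; rewrite letter_invK.
  by apply: contra zw => /eqP/(can_inj (@letter_invK A)) ->.
rewrite /conj_letter conjgE invgK of_letterV.
have Egz : word_of (g * of_letter (letter_inv z)) = rcons (word_of g) (letter_inv z).
  by rewrite word_of_mul /= cats1 //; apply: path_sorted rzg.
by rewrite word_of_mul Egz //.
Qed.

(** With two generators there are four letters, so up to three of them can be
    avoided. *)
Lemma avoid_letters (a b : A) m1 m2 m3 : a != b ->
  exists z : letter A, [/\ z != m1, z != m2 & z != m3].
Proof.
move=> ab; pose L : seq (letter A) := [:: (a, true); (a, false); (b, true); (b, false)].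
have uL : uniq L.
  rewrite /L /= !inE !negb_or -!pair_eqE /= !eqxx /=.
  by rewrite !andbT (negPf ab).
have /allPn[z _ zm] : ~~ all [in [:: m1; m2; m3]] L.
  by apply/negP => /allP sL; have := uniq_leq_size uL sL.
by exists z; move: zm; rewrite !inE !negb_or => /and3P[].
Qed.

(** Two conjugates starting with different letters do not commute, so
    commutators of conjugates of a nontrivial element are again nontrivial:
    the derived series of a nonabelian free group never reaches 1. *)
Lemma comm_values_neq1 (a b : A) k : a != b ->
  exists2 g : F, comm_values k g & g != 1.
Proof.
move=> ab; elim: k => [|k [g kg g1]]; first by exists (of_letter (a, true)).
have [z [zg gz _]] := avoid_letters (letter_inv (head (a, true) (word_of g)))
  (last (a, true) (word_of g)) (a, true) ab.
have [y [yg gy yz]] := avoid_letters (letter_inv (head (a, true) (word_of g)))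
  (last (a, true) (word_of g)) z ab.
have Ez := word_of_conj_letter g1 zg gz; have Ey := word_of_conj_letter g1 yg gy.
pose p := conj_letter z g; pose q := conj_letter y g.
exists [~ p, q].
  exists p; first exact: comm_valuesJ.
  by exists q => //; apply: comm_valuesJ.
apply/eqP => /eqP/commgP/(congr1 (@word_of A)).
have glue (u v : letter A) (x x' : F) : v != u ->
    word_of x = u :: rcons (word_of g) (letter_inv u) ->
    word_of x' = v :: rcons (word_of g) (letter_inv v) ->
    exists t, word_of (x * x') = u :: t.
  move=> vu Ex Ey'; eexists; rewrite word_of_mul Ex //.
  rewrite Ey' reduced_glue; apply/andP; split; last by rewrite -Ey' word_of_reduced.
  have rx := word_of_reduced x; rewrite Ex in rx.
  rewrite rcons_cons [X in is_true X]rcons_path; apply/andP; split=> //.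
  by rewrite last_rcons letter_invK.
have zy : z != y by rewrite eq_sym.
have [t ->] := glue z y p q yz Ez Ey; have [t' ->] := glue y z q p zy Ey Ez.
by case=> E _; rewrite E eqxx in yz.
Qed.

(** Three letters have to be avoided: the two that would cancel against [n], and
    the inverse of the last letter of [g]. Then nothing cancels in the
    conjugate, which therefore starts with [g]. *)
Lemma free_take_conj (a b : A) g n : a != b -> n != 1 ->
  exists z, free_take (size (word_of g)) (n ^ (g * of_letter z)^-1) = g.
Proof.
move=> ab n1.
have [z [zn nz gz]] := avoid_letters (letter_inv (head (a, true) (word_of n)))
  (last (a, true) (word_of n)) (letter_inv (last (a, true) (word_of g))) ab.
exists z; rewrite invgM conjgM -/(conj_letter z n).
have {zn nz} Ez : word_of (conj_letter z n) = z :: rcons (word_of n) (letter_inv z).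
  exact: word_of_conj_letter n1 zn nz.
have rgz : reduced (rcons (word_of g) z).
  case: (word_of g) gz (word_of_reduced g) => //= l w gz.
  by rewrite /reduced /= rcons_path => ->.
have Egz : word_of (g * of_letter z) = rcons (word_of g) z.
  by rewrite word_of_mul /= cats1.
have Egzn : word_of (g * conj_letter z n) =
    word_of g ++ z :: rcons (word_of n) (letter_inv z).
  by rewrite word_of_mul Ez // reduced_glue rgz -Ez word_of_reduced.
have E : word_of (g * conj_letter z n * g^-1) =
    word_of g ++ z :: rcons (word_of n) (letter_inv z) ++ word_of g^-1.
  rewrite word_of_mul Egzn; first by rewrite -catA.
  rewrite -rcons_cons -rcons_cat cat_rcons reduced_glue.
  have := word_of_reduced (g * conj_letter z n); rewrite Egzn.
  rewrite -rcons_cons -rcons_cat => ->.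
  suff <- : word_of (of_letter (letter_inv z) * g^-1) = letter_inv z :: word_of g^-1.
    exact: word_of_reduced.
  rewrite -of_letterV -invgM -[LHS]/(word_inv (word_of (g * of_letter z))) Egz.
  by rewrite /word_inv map_rcons rev_rcons.
apply: free_inj; rewrite word_of_take conjgE invgK mulgA E.
by rewrite take_size_cat.
Qed.

Lemma covered_all (a b : A) k (H : set F) s g : a != b ->
  H = generated [set` s] -> derived_subgroup F k `<=` H ->
  covered H (prefixes s) g.
Proof.
move=> ab HE kH; have [n kn n1] := comm_values_neq1 k ab.
have [z Ez] := free_take_conj g ab n1; rewrite -Ez.
apply: covered_prefix => //.
by apply: kH; apply: derivedJ; apply: comm_values_derived.
Qed.

(** When the cosets of prefixes miss something, they already miss an element
    one letter longer than a prefix; whence a short conjugate of [n] outside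
    the subgroup. *)
Lemma short_conj_notin (a b : A) (H : set F) s n : a != b -> n != 1 ->
  H = generated [set` s] -> ~ (forall g, covered H (prefixes s) g) ->
  exists2 p, p \in prefixes s & exists l z,
    ~ H (n ^ (p * of_letter l * of_letter z)^-1).
Proof.
move=> ab n1 HE; have sH : is_subgroup H by rewrite HE; apply: generated_subgroup.
apply: contra_notP => nH; apply: free_ind => [|g l [p ps Hgp]].
  by apply: covered_mem => //; rewrite mem_head.
suff: covered H (prefixes s) (p * of_letter l).
  by move/(coveredM sH Hgp); rewrite mulgA mulgVK.
have [z Ez] := free_take_conj (p * of_letter l) ab n1; rewrite -Ez.
apply: covered_prefix => //; apply: contrapT => nHz.
by apply: nH; exists p => //; exists l, z.
Qed.

End Conjugates.

(** ** Finite index and finite generation *)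

Section FiniteIndex.
Variable A : choiceType.
Notation F := (free_group A).
Implicit Types (g h x : F) (l m z : letter A) (s : seq F) (K : set F).

Lemma finitely_generatedP (G : groupType) (H : set G) :
  finitely_generated H -> exists s : seq G, H = generated [set` s].
Proof. by case=> S /finite_seqP[s ->] ->; exists s. Qed.

Lemma finite_letters :
  finite_set [set: A] -> exists ls : seq (letter A), forall l, l \in ls.
Proof.
case/finite_seqP => t tA; exists [seq (a, b) | a <- t, b <- [:: true; false]].
case=> a b; apply/allpairsP; exists (a, b); split=> //=; last by case: b.
by have : [set: A] a by []; rewrite tA.
Qed.

(** Schreier: the elements $t l t'^{-1}$ of [K], for a letter $l$ and coset
    representatives $t$, $t'$, together with the representative of the trivial
    coset, generate [K]. *)
Lemma finite_index_fg K : is_subgroup K -> finite_set [set: A] ->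
  finite_index K -> finitely_generated K.
Proof.
move=> sK /finite_letters[ls lsP] /(finite_indexP sK)[xs xsP].
have rP g : exists x, x \in xs /\ K (g * x^-1).
  by have [x xxs Kgx] := xsP g; exists x.
pose r g := projT1 (cid (rP g)).
have [rxs Kr] : (forall g, r g \in xs) /\ (forall g, K (g * (r g)^-1)).
  by split=> g; rewrite /r; case: cid => x /= [].
pose M := [seq x * of_letter l | x <- xs, l <- ls].
pose S0 := [seq c * y^-1 | c <- M, y <- xs] ++ xs.
pose S := [set g | g \in S0 /\ K g].
have SK : generated S `<=` K by apply: generated_min => // g [].
have sS := generated_subgroup S.
exists S.
  by apply: (@sub_finite_set _ _ [set` S0]); [move=> g [] | apply: finite_seq].
apply/seteqP; split=> // g Kg.
have rS h : K h -> generated S (r h).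
  move=> Kh; apply: sub_generated; split; first by rewrite mem_cat rxs orbT.
  have := subgroupM sK (subgroupV sK (Kr h)) Kh.
  by rewrite invgM invgK mulgVK.
have Sr h : generated S (h * (r h)^-1).
  elim/free_ind: h => [|h l IHh].
    by rewrite mul1g; apply: (subgroupV sS); apply: rS; apply: sK.1.
  suff: generated S (r h * of_letter l * (r (h * of_letter l))^-1).
    by move/(subgroupM sS IHh); rewrite !mulgA mulgVK.
  apply: sub_generated; split.
    rewrite mem_cat; apply/orP; left.
    apply: (allpairs_f (fun c y => c * y^-1)) => //.
    by apply: (allpairs_f (fun x l => x * of_letter l)).
  have := subgroupM sK (subgroupV sK (Kr h)) (Kr (h * of_letter l)).
  by rewrite invgM invgK !mulgA mulgVK.
by rewrite -(mulgVK (r g) g); apply: (subgroupM sS); last exact: rS.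
Qed.

Lemma rank1_letter (A1 : forall a b : A, a = b) l m : l = m \/ l = letter_inv m.
Proof.
case: l => [a b]; case: m => [a' b']; rewrite /letter_inv /= (A1 a a').
by case: b; case: b'; [left|right|right|left].
Qed.

(** All elements are powers of one letter $c$, so [K] contains some $c^n$ with
    $n > 0$, and $1, c, \ldots, c^{n-1}$ represent all its cosets. *)
Lemma rank1_finite_index K h : is_subgroup K -> (forall a b : A, a = b) ->
  K h -> h != 1 -> finite_index K.
Proof.
move=> sK A1 Kh h1.
case Eh: (word_of h) => [|m w]; first by case/eqP: h1; apply: free_inj.
pose c := of_letter m.
have lP l : of_letter l = c \/ of_letter l = c^-1.
  by rewrite of_letterV; have [->|->] := rank1_letter A1 l m; [left | right].
have [n n0 Kn] : exists2 n, (0 < n)%N & K (c ^+ n).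
  have [n] : exists n, h = c ^+ n \/ h = c ^- n.
    elim/free_ind: (h) => [|g l [n [|] ->]]; first by exists 0%N; left.
      case: (lP l) => ->; first by exists n.+1; left; rewrite expgSr.
      case: n => [|n]; first by exists 1%N; right; rewrite mul1g.
      by exists n; left; rewrite expgSr mulgK.
    case: (lP l) => ->; last by exists n.+1; right; rewrite expgS invgM.
    case: n => [|n]; first by exists 1%N; left; rewrite invg1 mul1g.
    by exists n; right; rewrite expgS invgM mulgVK.
  move=> E; exists n; first by case: n E h1 => // -[] ->; rewrite ?invg1 eqxx.
  by case: E Kh => -> // /(subgroupV sK); rewrite invgK.
apply/(finite_indexP sK); exists [seq c ^+ i | i <- iota 0 n].
have cov i : (i < n)%N -> covered K [seq c ^+ i | i <- iota 0 n] (c ^+ i).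
  move=> ltin; apply: covered_mem => //.
  by apply/mapP; exists i => //; rewrite mem_iota.
apply: free_ind => [|g l [_ /mapP[i + ->] Kg]]; first exact: (cov 0%N).
rewrite mem_iota => /= ltin.
suff: covered K [seq c ^+ i | i <- iota 0 n] (c ^+ i * of_letter l).
  by move/(coveredM sK Kg); rewrite mulgA mulgVK.
case: (lP l) => ->.
  rewrite -expgSr; have [|le_ni] := ltnP i.+1 n; first exact: cov.
  have -> : i.+1 = n by apply/eqP; rewrite eqn_leq ltin.
  by rewrite -[c ^+ n]mulg1; apply: coveredM => //; apply: (cov 0%N).
case: i {Kg} ltin => [|i] ltin; last first.
  by rewrite expgSr mulgK; apply: cov; apply: ltnW.
have -> : c ^+ 0 * c^-1 = c ^- n * c ^+ n.-1.
  by rewrite -{1}(prednK n0) expgSr invgM mulgVK mul1g.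
by apply: coveredM; [|apply: (subgroupV sK)|apply: cov; rewrite ltn_predL].
Qed.

Lemma free_lift_morph (R : groupType) (f : A -> R) :
  let ev1 (l : letter A) := if l.2 then f l.1 else (f l.1)^-1 in
  {morph (fun g : F => foldr (fun (l : letter A) (y : R) => ev1 l * y) 1
    (word_of g)) : g h / g * h}.
Proof.
move=> ev1 g h; pose ev w := foldr (fun (l : letter A) (y : R) => ev1 l * y) 1 w.
suff E w : ev (word_mul w (word_of h)) = ev w * ev (word_of h) by apply: E.
elim: w => [|l w IHw]; first by rewrite mul1g.
rewrite [LHS]/= [ev (l :: w)]/= -mulgA -IHw.
case: (word_mul w _) => [|m v] //=; case: eqP => [->|//].
suff -> : ev1 (letter_inv l) = (ev1 l)^-1 by rewrite mulVKg.
by case: l => a [] /=; rewrite /ev1 /= ?invgK.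
Qed.

Definition free_lift (R : groupType) (f : A -> R) : {multiplicative F -> R} :=
  HB.pack (fun g : F => foldr (fun (l : letter A) (y : R) =>
      (if l.2 then f l.1 else (f l.1)^-1) * y) 1 (word_of g))
    (isMultiplicative.Build F R _ (free_lift_morph f)).

Lemma free_lift_letter (R : groupType) (f : A -> R) a b :
  free_lift f (of_letter (a, b)) = if b then f a else (f a)^-1.
Proof. exact: mulg1. Qed.

End FiniteIndex.

(** * Permutation representations on finite sets of cosets *)

(** The complements of the domain and of the image of an injection have the same
    cardinality, so enumerations of both complete it. *)
Lemma extend_perm (T : finType) (D : {set T}) (f : T -> T) :
  {in D &, injective f} -> exists s : {perm T}, {in D, s =1 f}.
Proof.
move=> fI; pose E := (f @: D)%SET.
have cDE : #|~: D| = #|~: E|.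
  by apply: (@addnI #|D|); rewrite cardsC -{1}(card_in_imset fI) cardsC.
pose g x := if x \in D then f x else nth x (enum (~: E)) (index x (enum (~: D))).
have gD x : x \in D -> g x \in E.
  by move=> xD; rewrite /g xD; apply: imset_f.
have ix x : x \notin D -> (index x (enum (~: D)) < size (enum (~: E)))%N.
  by move=> xD; rewrite -cardE -cDE cardE index_mem mem_enum inE.
have gND x : x \notin D -> g x \notin E.
  move=> xD; rewrite /g (negPf xD).
  by have := mem_nth x (ix x xD); rewrite mem_enum inE.
have gI : injective g.
  move=> x y; have [[xD|xD] [yD|yD]] := (boolP (x \in D), boolP (y \in D)).
  - by rewrite /g xD yD; apply: fI.
  - by move=> E'; have := gND y yD; rewrite -E' gD.
  - by move=> E'; have := gND x xD; rewrite E' gD.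
  rewrite /g (negPf xD) (negPf yD) (set_nth_default x y (ix y yD)) => /eqP.
  rewrite nth_uniq ?ix ?enum_uniq // => /eqP.
  have xE : x \in enum (~: D) by rewrite mem_enum inE.
  have yE : y \in enum (~: D) by rewrite mem_enum inE.
  by move/(congr1 (nth x (enum (~: D)))); rewrite !nth_index.
by exists (perm gI) => x xD; rewrite permE /g xD.
Qed.

Section CosetRepresentation.
Variable A : choiceType.
Notation F := (free_group A).
Implicit Types (g h x y : F) (s xs : seq F) (H : set F).

(** M. Hall's argument: on finitely many cosets, right multiplication by a
    letter is a partial injection, which extends to a permutation. The
    resulting action of the free group agrees with right multiplication along
    every word that never leaves the chosen cosets. *)
Lemma coset_representation H xs : is_subgroup H -> 1 \in xs ->
  exists (T : finType) (rho : {multiplicative F -> {perm T}}) (c : F -> T),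
  [/\ (#|T| <= size xs)%N,
      forall x y, covered H xs x -> covered H xs y -> c x = c y <-> H (x * y^-1),
      forall t, exists2 x, covered H xs x & c x = t
    & forall x g, (forall n, covered H xs (x * free_take n g)) ->
        rho g (c x) = c (x * g)].
Proof.
move=> sH xs1.
pose rs g : set F := [set y | y \in xs /\ H (g * y^-1)].
pose r g := xget 1 (rs g).
have rP g : covered H xs g -> r g \in xs /\ H (g * (r g)^-1).
  move=> [x xxs Hgx]; rewrite /r; case: xgetP => [y _ [//]|/(_ x)[]].
  by split.
have rs_eq x y : H (x * y^-1) -> rs x = rs y.
  move=> Hxy; apply/seteqP; split=> z [zxs Hz]; split=> //.
    have := subgroupM sH (subgroupV sH Hxy) Hz.
    by rewrite invgM invgK mulgA mulgVK.
  by have := subgroupM sH Hxy Hz; rewrite mulgA mulgVK.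
pose ys := undup [seq r x | x <- xs].
have r_ys g : covered H xs g -> r g \in ys.
  move=> [x xxs Hgx]; rewrite mem_undup; apply/mapP; exists x => //.
  by rewrite /r (rs_eq _ _ Hgx).
have cov1 : covered H xs 1 by apply: covered_mem.
pose t1 : seq_sub ys := SeqSub (r_ys 1 cov1).
pose c g : seq_sub ys := insubd t1 (r g).
have cE g : covered H xs g -> val (c g) = r g.
  by move=> cg; rewrite /c insubdK //; apply: (r_ys g).
have cP x y : covered H xs x -> covered H xs y -> c x = c y <-> H (x * y^-1).
  move=> cx cy; split=> [/(congr1 val)|Hxy]; last first.
    by rewrite /c /r (rs_eq _ _ Hxy).
  rewrite !cE // => Exy; have [_ Hx] := rP x cx; have [_ Hy] := rP y cy.
  have := subgroupM sH Hx (subgroupV sH Hy).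
  by rewrite Exy invgM invgK mulgA mulgVK.
have cS t : exists2 x, covered H xs x & c x = t.
  have := valP t; rewrite mem_undup => /mapP[x xxs Et].
  by exists x; [apply: covered_mem | apply: val_inj; rewrite cE //; apply: covered_mem].
have sigmaP a : exists p : {perm seq_sub ys}, forall x,
    covered H xs x -> covered H xs (x * of_letter (a, true)) ->
    p (c x) = c (x * of_letter (a, true)).
  pose D := [set t | `[< exists x, [/\ covered H xs x,
    covered H xs (x * of_letter (a, true)) & c x = t] >]]%SET.
  pose rep t := xget 1 [set x | [/\ covered H xs x,
    covered H xs (x * of_letter (a, true)) & c x = t]].
  have repP t : t \in D -> [/\ covered H xs (rep t),
      covered H xs (rep t * of_letter (a, true)) & c (rep t) = t].
    rewrite inE => /asboolP[x xP].
    by rewrite /rep; case: xgetP => [y _ //|/(_ x)[]].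
  have cM x y : c x = c y -> covered H xs x -> covered H xs y ->
      covered H xs (x * of_letter (a, true)) ->
      covered H xs (y * of_letter (a, true)) ->
      c (x * of_letter (a, true)) = c (y * of_letter (a, true)).
    move=> Exy cx cy cxa cya; apply/(cP _ _ cxa cya).
    by rewrite invgM mulgA mulgK; apply/(cP _ _ cx cy).
  have [t u tD uD|p pP] := @extend_perm _ D (fun t => c (rep t * of_letter (a, true))).
    have [ct cta Et] := repP t tD; have [cu cua Eu] := repP u uD.
    move/(cP _ _ cta cua); rewrite invgM mulgA mulgK => /(cP _ _ ct cu).
    by rewrite Et Eu.
  exists p => x cx cxa; have cxD : c x \in D by rewrite inE; apply/asboolP; exists x.
  by rewrite pP //; have [cr cra Er] := repP _ cxD; apply: cM.
pose sigma a := projT1 (cid (sigmaP a)).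
have sE a x : covered H xs x -> covered H xs (x * of_letter (a, true)) ->
    sigma a (c x) = c (x * of_letter (a, true)).
  by rewrite /sigma; case: cid => p /= pP; apply: pP.
exists (seq_sub ys), (free_lift sigma), c; split=> // [|x g cg].
  rewrite card_seq_sub ?undup_uniq //.
  by apply: leq_trans (size_undup _) _; rewrite size_map.
suff Ei i : (i <= size (word_of g))%N ->
    free_lift sigma (free_take i g) (c x) = c (x * free_take i g).
  by have := Ei _ (leqnn _); rewrite free_take_ge.
elim: i => [|i IHi] ig; first by rewrite free_take0 multiplicative1 perm1 mulg1.
have [l El] := free_takeS ig; have := cg i.+1; rewrite El mulgA.
rewrite gmulfM permM IHi; last exact: ltnW.
case: l {El} => a [] cgi; rewrite free_lift_letter; first exact: sE.
have Ea : of_letter (a, false) = (of_letter (a, true))^-1 by rewrite of_letterV.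
have := sE a _ cgi; rewrite {1 3}Ea mulgVK => /(_ (cg i)) <-.
by rewrite permK.
Qed.

(** Here all cosets are represented, and the derived subgroup, being normal and
    contained in [H], fixes every one of them. *)
Lemma sub_derived_closed (a b : A) k H s : a != b ->
  H = generated [set` s] -> derived_subgroup F k `<=` H ->
  pro_closed (finite_solvable k) H.
Proof.
move=> ab HE kH; have sH : is_subgroup H by rewrite HE; apply: generated_subgroup.
have cov g : covered H (prefixes s) g by apply: covered_all ab HE kH.
have [|T [rho [c [_ cP cS rhoE]]]] := @coset_representation H (prefixes s) sH.
  exact: mem_head.
apply/seteqP; split; last exact: sub_pro_closure.
move=> x; apply: contraPP => Hx.
apply: (@notin_pro_closure k _ T rho H x (c 1)) => // [y ky|h Hh|].
- apply/permP => t; have [z _ <-] := cS t; rewrite perm1 rhoE //.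
  apply/cP => //; have := kH _ (derivedJ z^-1 ky).
  by rewrite conjgE invgK mulgA.
- by rewrite rhoE // mul1g; apply/cP => //; rewrite invg1 mulg1.
apply/eqP; rewrite rhoE // mul1g => /cP.
by rewrite invg1 mulg1 => /(_ (cov _) (cov _)).
Qed.

Lemma rank1_comm : (forall a b : A, a = b) -> forall x y : F, x * y = y * x.
Proof.
move=> A1; have comm (l m : letter A) : commute (of_letter l) (of_letter m).
  have [->//|->] := rank1_letter A1 l m.
  by rewrite -of_letterV; apply/commute_sym/commuteV.
move=> x y; elim/free_ind: x => [|x l IHx]; first by rewrite mul1g mulg1.
apply/commute_sym/commuteM; first exact/commute_sym.
elim/free_ind: y {IHx} => [|y m IHy]; first exact/commute_sym/commute1.
by apply/commute_sym/commuteM; [apply/commute_sym | apply: comm].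
Qed.

(** The derived subgroup is trivial, so every finite permutation representation
    is allowed, and Hall's argument separates [H] from any outside element. *)
Lemma rank1_closed k H s : (1 <= k)%N -> (forall a b : A, a = b) ->
  H = generated [set` s] -> pro_closed (finite_solvable k) H.
Proof.
move=> k1 A1 HE; have sH : is_subgroup H by rewrite HE; apply: generated_subgroup.
have k_trivial : derived_subgroup F k `<=` [set 1].
  case: k k1 => // k _; apply/derived_sub.
    by split=> // y z -> ->; rewrite invg1 mulg1.
  move=> _ [y _ [z _ <-]]; apply/eqP/commgP; exact: rank1_comm.
apply/seteqP; split; last exact: sub_pro_closure.
move=> x; apply: contraPP => Hx.
pose xs := prefixes (x :: s).
have sub_xs g : g \in prefixes s -> g \in xs.
  case/prefixesP=> [->|[h hs [n ->]]]; first exact: mem_head.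
  by apply: mem_prefixes; rewrite inE hs orbT.
have covH h n : H h -> covered H xs (free_take n h).
  by move=> Hh; have [p /sub_xs ps Hp] := covered_prefix n HE Hh; exists p.
have covx n : covered H xs (free_take n x).
  by apply: covered_mem => //; apply: mem_prefixes; rewrite mem_head.
have [|T [rho [c [_ cP cS rhoE]]]] := @coset_representation H xs sH.
  exact: mem_head.
have cov1 : covered H xs 1 by have := covx 0%N; rewrite free_take0.
have covx' : covered H xs x by have := covx (size (word_of x)); rewrite free_take_ge.
apply: (@notin_pro_closure k _ T rho H x (c 1)) => // [y /k_trivial -> |h Hh|].
- exact: multiplicative1.
- rewrite rhoE => [|n]; last by rewrite mul1g; apply: covH.
  rewrite mul1g; apply/cP => //; last by rewrite invg1 mulg1.
  by have := covH h (size (word_of h)) Hh; rewrite free_take_ge.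
apply/eqP; rewrite rhoE => [|n]; last by rewrite mul1g.
by rewrite mul1g => /(cP _ _ covx' cov1); rewrite invg1 mulg1.
Qed.

End CosetRepresentation.

(** * Recursive functions *)

Section Recursive.
Local Open Scope nat_scope.
Implicit Types (F G H : seq nat -> nat) (P Q : seq nat -> bool) (n i j : nat).

(** Functions of a list of arguments, so that adding a bound variable to a
    context is consing, and the older variables are found by dropping it. *)
Definition rec_at n F : Prop := recursive (fun v : n.-tuple nat => F v).

Lemma rec_at_ext n F G :
  (forall v, size v = n -> F v = G v) -> rec_at n F -> rec_at n G.
Proof.
move=> FG; rewrite /rec_at.
by have -> // : (fun v : n.-tuple nat => G v) = (fun v : n.-tuple nat => F v);
  apply: funext => v; rewrite FG ?size_tuple.
Qed.

Lemma rec_nth n i F : i < n -> (forall v, F v = nth 0 v i) -> rec_at n F.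
Proof.
move=> ltin FE; apply: (@rec_at_ext n (fun v => nth 0 v i)) => [v _|].
  by rewrite FE.
rewrite /rec_at; have -> : (fun v : n.-tuple nat => nth 0 v i) =
    (fun v : n.-tuple nat => tnth v (Ordinal ltin)).
  by apply: funext => v; rewrite (tnth_nth 0).
exact: recursive_proj.
Qed.

Lemma rec_comp m n F (gs : seq (seq nat -> nat)) : size gs = m -> rec_at m F ->
  (forall i, i < m -> rec_at n (nth (fun=> 0) gs i)) ->
  rec_at n (fun v => F [seq g v | g <- gs]).
Proof.
move=> sgs rF rgs; rewrite /rec_at.
have -> : (fun v : n.-tuple nat => F [seq g (tval v) | g <- gs]) =
    (fun v : n.-tuple nat => F [tuple nth (fun=> 0) gs i (tval v) | i < m]).
  apply: funext => v; congr F; apply: (@eq_from_nth _ 0).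
    by rewrite size_tuple size_map.
  move=> i; rewrite size_map => igs; rewrite (nth_map (fun=> 0)) //.
  have ltim : i < m by rewrite -sgs.
  by rewrite -[i in RHS]/(nat_of_ord (Ordinal ltim)) -tnth_nth tnth_mktuple.
by apply: (recursive_comp rF) => i; apply: rgs.
Qed.

Lemma rec_comp1 n (f : nat -> nat) F : rec_at 1 (fun v => f (nth 0 v 0)) ->
  rec_at n F -> rec_at n (fun v => f (F v)).
Proof.
move=> rf rF; apply: (@rec_comp 1 n (fun v => f (nth 0 v 0)) [:: F]) => //.
by case.
Qed.

Lemma rec_comp2 n (f : nat -> nat -> nat) F G :
  rec_at 2 (fun v => f (nth 0 v 0) (nth 0 v 1)) ->
  rec_at n F -> rec_at n G -> rec_at n (fun v => f (F v) (G v)).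
Proof.
move=> rf rF rG.
apply: (@rec_comp 2 n (fun v => f (nth 0 v 0) (nth 0 v 1)) [:: F; G]) => //.
by case=> [|[]].
Qed.

Lemma rec_comp3 n (f : nat -> nat -> nat -> nat) F G H :
  rec_at 3 (fun v => f (nth 0 v 0) (nth 0 v 1) (nth 0 v 2)) ->
  rec_at n F -> rec_at n G -> rec_at n H ->
  rec_at n (fun v => f (F v) (G v) (H v)).
Proof.
move=> rf rF rG rH.
apply: (@rec_comp 3 n (fun v => f (nth 0 v 0) (nth 0 v 1) (nth 0 v 2))
  [:: F; G; H]) => //.
by case=> [|[|[]]].
Qed.

Lemma rec_const n c : rec_at n (fun=> c).
Proof.
elim: c => [|c IHc]; first exact: recursive_zero.
apply: (@rec_comp1 n succn _ _ IHc).
rewrite /rec_at; have -> : (fun v : 1.-tuple nat => (nth 0 v 0).+1) =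
    (fun v : 1.-tuple nat => (thead v).+1).
  by apply: funext => v; rewrite /thead (tnth_nth 0).
exact: recursive_succ.
Qed.

Lemma rec_succ n F : rec_at n F -> rec_at n (fun v => (F v).+1).
Proof.
move=> rF; apply: (@rec_comp1 n succn _ _ rF).
rewrite /rec_at; have -> : (fun v : 1.-tuple nat => (nth 0 v 0).+1) =
    (fun v : 1.-tuple nat => (thead v).+1).
  by apply: funext => v; rewrite /thead (tnth_nth 0).
exact: recursive_succ.
Qed.

Lemma rec_iteri n B (G : nat -> nat -> seq nat -> nat) F :
  rec_at n B -> rec_at n.+2 (fun v => G (nth 0 v 0) (nth 0 v 1) (drop 2 v)) ->
  rec_at n F -> rec_at n (fun v => iteri (B v) (fun i acc => G i acc v) (F v)).
Proof.
move=> rB rG rF.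
pose R w := iteri (nth 0 w 0) (fun i acc => G i acc (drop 1 w)) (F (drop 1 w)).
have rR : rec_at n.+1 R.
  have := recursive_prim rF rG; rewrite /rec_at.
  congr recursive; apply: funext => v; rewrite /R drop1.
  have <- : thead v = nth 0 v 0 by rewrite /thead (tnth_nth 0).
  by elim: (thead v) => //= m ->; rewrite drop0.
apply: (@rec_at_ext n (fun v => R [seq g v | g <- B ::
    [seq (fun w => nth 0 w i) | i <- iota 0 n]])).
  move=> v sv; rewrite /R /= drop0 -map_comp.
  suff -> : [seq (fun w => nth 0 w i) v | i <- iota 0 n] = v by [].
  by rewrite -[RHS](mkseq_nth 0) sv.
apply: rec_comp rR _ => /=; first by rewrite size_map size_iota.
case=> [|i] //= lti; rewrite (nth_map 0) ?size_iota //.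
by apply: (@rec_nth n i) => // v; rewrite nth_iota.
Qed.

End Recursive.

(** An outer variable sits behind as many nested drops as there are binders above
    it; composing the drops leaves a plain projection. *)
Ltac rec_var :=
  eapply rec_nth; [|by move=> ?; rewrite ?nth_drop ?add0n; reflexivity]; by [].

Section Arithmetic.
Local Open Scope nat_scope.
Implicit Types (F G H : seq nat -> nat) (P Q : seq nat -> bool) (n i j : nat).

Lemma rec_add n F G : rec_at n F -> rec_at n G -> rec_at n (fun v => F v + G v).
Proof.
apply: (@rec_comp2 n addn).
apply: (@rec_at_ext 2 (fun v => iteri (nth 0 v 0) (fun _ acc => acc.+1) (nth 0 v 1))).
  by move=> v _; elim: (nth 0 v 0) => //= m ->.
apply: (@rec_iteri _ _ (fun _ acc _ => acc.+1)); [rec_var| |rec_var].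
apply: rec_succ; rec_var.
Qed.

Lemma rec_pred n F : rec_at n F -> rec_at n (fun v => (F v).-1).
Proof.
apply: (@rec_comp1 n predn).
apply: (@rec_at_ext 1 (fun v => iteri (nth 0 v 0) (fun i _ => i) 0)).
  by move=> v _; case: (nth 0 v 0).
by apply: (@rec_iteri _ _ (fun i _ _ => i)); [rec_var|rec_var|apply: rec_const].
Qed.

Lemma rec_sub n F G : rec_at n F -> rec_at n G -> rec_at n (fun v => F v - G v).
Proof.
apply: (@rec_comp2 n subn).
apply: (@rec_at_ext 2 (fun v => iteri (nth 0 v 1) (fun _ acc => acc.-1) (nth 0 v 0))).
  by move=> v _; elim: (nth 0 v 1) => [|m /= ->]; rewrite ?subn0 ?subnS.
apply: (@rec_iteri _ _ (fun _ acc _ => acc.-1)); [rec_var| |rec_var].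
apply: rec_pred; rec_var.
Qed.

Lemma rec_mul n F G : rec_at n F -> rec_at n G -> rec_at n (fun v => F v * G v).
Proof.
apply: (@rec_comp2 n muln).
apply: (@rec_at_ext 2 (fun v => iteri (nth 0 v 0) (fun _ acc => acc + nth 0 v 1) 0)).
  by move=> v _; elim: (nth 0 v 0) => //= m ->; rewrite mulSn addnC.
apply: (@rec_iteri _ _ (fun _ acc v => acc + nth 0 v 1)); [rec_var| |exact: rec_const].
apply: rec_add; rec_var.
Qed.

Lemma rec_exp n F G : rec_at n F -> rec_at n G -> rec_at n (fun v => F v ^ G v).
Proof.
apply: (@rec_comp2 n expn).
apply: (@rec_at_ext 2 (fun v => iteri (nth 0 v 1) (fun _ acc => acc * nth 0 v 0) 1)).
  by move=> v _; elim: (nth 0 v 1) => //= m ->; rewrite expnSr.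
apply: (@rec_iteri _ _ (fun _ acc v => acc * nth 0 v 0)); [rec_var| |exact: rec_const].
apply: rec_mul; rec_var.
Qed.

Lemma rec_fact n F : rec_at n F -> rec_at n (fun v => (F v)`!).
Proof.
apply: (@rec_comp1 n factorial).
apply: (@rec_at_ext 1 (fun v => iteri (nth 0 v 0) (fun i acc => i.+1 * acc) 1)).
  by move=> v _; elim: (nth 0 v 0) => //= m ->.
apply: (@rec_iteri _ _ (fun i acc _ => i.+1 * acc)); [rec_var| |exact: rec_const].
apply: rec_mul; [apply: rec_succ|]; rec_var.
Qed.

Lemma rec_not n P : rec_at n P -> rec_at n (fun v => ~~ P v).
Proof.
move=> rP; apply: (@rec_at_ext n (fun v => 1 - P v)) => [v _|]; first by case: (P v).
by apply: rec_sub => //; apply: rec_const.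
Qed.

Lemma rec_and n P Q : rec_at n P -> rec_at n Q -> rec_at n (fun v => P v && Q v).
Proof.
move=> rP rQ; apply: (@rec_at_ext n (fun v => P v * Q v)) => [v _|].
  by rewrite mulnb.
exact: rec_mul.
Qed.

Lemma rec_or n P Q : rec_at n P -> rec_at n Q -> rec_at n (fun v => P v || Q v).
Proof.
move=> rP rQ; apply: (@rec_at_ext n (fun v => ~~ (~~ P v && ~~ Q v))) => [v _|].
  by rewrite negb_and !negbK.
by apply: rec_not; apply: rec_and; apply: rec_not.
Qed.

Lemma rec_imply n P Q : rec_at n P -> rec_at n Q -> rec_at n (fun v => P v ==> Q v).
Proof.
move=> rP rQ; apply: (@rec_at_ext n (fun v => ~~ P v || Q v)) => [v _|].
  by rewrite implybE.
by apply: rec_or => //; apply: rec_not.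
Qed.

Lemma rec_leq n F G : rec_at n F -> rec_at n G -> rec_at n (fun v => F v <= G v).
Proof.
move=> rF rG; apply: (@rec_at_ext n (fun v => 1 - (F v - G v))) => [v _|].
  by rewrite -subn_eq0; case: (F v - G v) => // m; rewrite subSS sub0n.
by apply: rec_sub; [apply: rec_const | apply: rec_sub].
Qed.

Lemma rec_eq n F G : rec_at n F -> rec_at n G -> rec_at n (fun v => F v == G v).
Proof.
move=> rF rG; apply: (@rec_at_ext n (fun v => (F v <= G v) && (G v <= F v))) => [v _|].
  by rewrite eqn_leq.
by apply: rec_and; apply: rec_leq.
Qed.

Lemma rec_mem n F (s : seq nat) : rec_at n F -> rec_at n (fun v => F v \in s).
Proof.
move=> rF; elim: s => [|x s IHs].
  by apply: (@rec_at_ext n (fun=> 0)) => [v _|]; rewrite ?in_nil //; apply: rec_const.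
apply: (@rec_at_ext n (fun v => (F v == x) || (F v \in s))) => [v _|].
  by rewrite in_cons.
by apply: rec_or => //; apply: rec_eq => //; apply: rec_const.
Qed.

Lemma rec_if n P F G : rec_at n P -> rec_at n F -> rec_at n G ->
  rec_at n (fun v => if P v then F v else G v).
Proof.
move=> rP rF rG.
apply: (@rec_at_ext n (fun v => P v * F v + (~~ P v) * G v)) => [v _|].
  by case: (P v); rewrite ?mul1n ?mul0n ?addn0.
by apply: rec_add; apply: rec_mul => //; apply: rec_not.
Qed.

Definition forall_below b (p : pred nat) := all p (iota 0 b).
Definition exists_below b (p : pred nat) := has p (iota 0 b).

Lemma forall_belowP b (p : pred nat) :
  reflect (forall i, i < b -> p i) (forall_below b p).
Proof.
apply: (iffP allP) => pb i; first by move=> ib; apply: pb; rewrite mem_iota.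
by rewrite mem_iota => /andP[_ ib]; apply: pb.
Qed.

Lemma exists_belowP b (p : pred nat) :
  reflect (exists2 i, i < b & p i) (exists_below b p).
Proof.
apply: (iffP hasP) => -[i ib pi]; exists i => //.
  by move: ib; rewrite mem_iota.
by rewrite mem_iota.
Qed.

Lemma rec_forall n B (P : nat -> seq nat -> bool) : rec_at n B ->
  rec_at n.+1 (fun v => P (nth 0 v 0) (drop 1 v)) ->
  rec_at n (fun v => forall_below (B v) (fun i => P i v)).
Proof.
move=> rB rP.
apply: (@rec_at_ext n (fun v => iteri (B v) (fun i acc => acc * P i v) 1)) => [v _|].
  elim: (B v) => //= m ->; rewrite /forall_below -[m.+1]addn1 iotaD all_cat.
  by rewrite add0n /= andbT mulnb.
apply: (@rec_iteri _ _ (fun i acc v => acc * P i v)) => //; last exact: rec_const.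
apply: rec_mul; first by rec_var.
apply: (@rec_at_ext _ (fun v => (fun w => P (nth 0 w 0) (drop 1 w))
    [seq g v | g <- (fun w => nth 0 w 0) ::
      [seq (fun w => nth 0 w i.+2) | i <- iota 0 n]])).
  move=> v sv /=; rewrite drop0 -map_comp; congr (nat_of_bool (P _ _)).
  rewrite -[RHS](mkseq_nth 0) size_drop sv subn2 /=.
  by apply: eq_map => i /=; rewrite nth_drop.
apply: rec_comp rP _ => /=; first by rewrite size_map size_iota.
case=> [|i] //= lti; first by rec_var.
by rewrite (nth_map 0) ?size_iota //; apply: (@rec_nth _ i.+2) => // v; rewrite nth_iota.
Qed.

Lemma rec_exists n B (P : nat -> seq nat -> bool) : rec_at n B ->
  rec_at n.+1 (fun v => P (nth 0 v 0) (drop 1 v)) ->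
  rec_at n (fun v => exists_below (B v) (fun i => P i v)).
Proof.
move=> rB rP; apply: (@rec_at_ext n
    (fun v => ~~ forall_below (B v) (fun i => ~~ P i v))) => [v _|].
  by rewrite /forall_below all_predC negbK.
apply: rec_not; apply: (@rec_forall _ _ (fun i v => ~~ P i v)) => //.
exact: rec_not.
Qed.

(** ** Coded lists *)

(** The code of a list with head $e$ and tail coded by $c$ is $2^e (2c + 1)$: the
    iteration stops at the number of halvings that first gives an odd number. *)
Definition code_head c :=
  iteri c (fun _ e => if odd (iteri e (fun _ x => x./2) c) then e else e.+1) 0.

Definition code_tail c := (iteri (code_head c) (fun _ x => x./2) c)./2.

Definition code_drop j c := iteri j (fun _ x => code_tail x) c.

Definition code_nth c j := code_head (code_drop j c).

Lemma rec_odd n F : rec_at n F -> rec_at n (fun v => odd (F v)).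
Proof.
apply: (@rec_comp1 n (fun x => odd x)).
apply: (@rec_at_ext 1 (fun v => iteri (nth 0 v 0) (fun _ acc => 1 - acc) 0)).
  by move=> v _; elim: (nth 0 v 0) => //= m ->; case: odd.
apply: (@rec_iteri _ _ (fun _ acc _ => 1 - acc)); [rec_var| |exact: rec_const].
by apply: rec_sub; [apply: rec_const|rec_var].
Qed.

Lemma rec_half n F : rec_at n F -> rec_at n (fun v => (F v)./2).
Proof.
apply: (@rec_comp1 n half).
apply: (@rec_at_ext 1 (fun v => iteri (nth 0 v 0) (fun i acc => odd i + acc) 0)).
  by move=> v _; elim: (nth 0 v 0) => //= m ->; rewrite uphalf_half.
apply: (@rec_iteri _ _ (fun i acc _ => odd i + acc)); [rec_var| |exact: rec_const].
by apply: rec_add; [apply: rec_odd|]; rec_var.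
Qed.

Let rec_halves n F G : rec_at n F -> rec_at n G ->
  rec_at n (fun v => iteri (F v) (fun _ x => x./2) (G v)).
Proof.
move=> rF rG; apply: (@rec_iteri _ _ (fun _ x _ => x./2)) => //.
by apply: rec_half; rec_var.
Qed.

Lemma rec_code_head n F : rec_at n F -> rec_at n (fun v => code_head (F v)).
Proof.
apply: (@rec_comp1 n code_head).
apply: (@rec_iteri _ _ (fun _ e v =>
  if odd (iteri e (fun _ x => x./2) (nth 0 v 0)) then e else e.+1)).
- by rec_var.
- apply: rec_if; last by apply: rec_succ; rec_var.
    by apply: rec_odd; apply: rec_halves; rec_var.
  by rec_var.
- exact: rec_const.
Qed.

Lemma rec_code_tail n F : rec_at n F -> rec_at n (fun v => code_tail (F v)).
Proof. by move=> rF; apply: rec_half; apply: rec_halves => //; apply: rec_code_head. Qed.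

Lemma rec_code_drop n F G : rec_at n F -> rec_at n G ->
  rec_at n (fun v => code_drop (F v) (G v)).
Proof.
move=> rF rG; apply: (@rec_iteri _ _ (fun _ x _ => code_tail x)) => //.
by apply: rec_code_tail; rec_var.
Qed.

Lemma rec_code_nth n F G : rec_at n F -> rec_at n G ->
  rec_at n (fun v => code_nth (F v) (G v)).
Proof. by move=> rF rG; apply: rec_code_head; apply: rec_code_drop. Qed.

Let code := CodeSeq.code.

Lemma halves_exp i e m : i <= e ->
  iteri i (fun _ x => x./2) (2 ^ e * m) = 2 ^ (e - i) * m.
Proof.
elim: i => [|i IHi] ie; first by rewrite subn0.
rewrite /= IHi 1?ltnW //; case: e {IHi} ie => // e ie.
by rewrite subSn // subSS expnS -mulnA mul2n doubleK.
Qed.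

Lemma code_headK e s : code_head (code (e :: s)) = e.
Proof.
rewrite /code_head; set c := code _.
have ltec : e < c by have /andP[] := CodeSeq.ltn_code (e :: s).
have cE : c = 2 ^ e * (code s).*2.+1 by [].
suff Ei i : iteri i (fun _ x => if odd (iteri x (fun _ x => x./2) c)
    then x else x.+1) 0 = minn i e.
  by rewrite Ei; apply/minn_idPr/ltnW.
elim: i => [|i /= ->]; first by rewrite min0n.
 have [lt_ie|le_ei] := ltnP i e.
  rewrite cE halves_exp 1?ltnW // (minn_idPl lt_ie).
  by rewrite oddM oddX subn_eq0 leqNgt lt_ie.
rewrite cE halves_exp // subnn expn0 mul1n /= odd_double.
by rewrite (minn_idPr (leqW le_ei)).
Qed.

Lemma code_tailK e s : code_tail (code (e :: s)) = code s.
Proof.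
rewrite /code_tail code_headK halves_exp // subnn expn0 mul1n.
exact: uphalf_double.
Qed.

Lemma code_dropE j s : code_drop j (code s) = code (drop j s).
Proof.
elim: j => [|j IHj]; first by rewrite drop0.
rewrite /code_drop /= -/(code_drop j (code s)) IHj -[j.+1]add1n -drop_drop.
by case: (drop j s) => [|e t] //; rewrite code_tailK /= drop0.
Qed.

Lemma code_nthE s j : j < size s -> code_nth (code s) j = nth 0 s j.
Proof.
by move=> js; rewrite /code_nth code_dropE (drop_nth 0 js) code_headK.
Qed.

Lemma code_eq0 s : (code s == 0) = (s == [::]).
Proof. by case: s => //= e s; rewrite muln_eq0 expn_eq0. Qed.

Lemma size_le_code s : size s + sumn s <= code s.
Proof.
elim: s => //= e s IHs; have := ltn_expl e (ltnSn 1) => e2.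
apply: (@leq_trans (e.+1 + code s)); first by lia.
rewrite -muln2 mulnS addnC addnC; apply: leq_add => //.
by rewrite mulnCA; apply: leq_pmulr; rewrite muln_gt0 expn_gt0.
Qed.

(** A crude bound, but any recursive one makes the searches below finite. *)
Lemma code_lt m b s : size s <= m -> all (fun x => x < b) s -> code s < 2 ^ (m * b).
Proof.
elim: m s => [|m IHm] [|e s] //=; first by rewrite expn_gt0.
rewrite ltnS => sm /andP[eb sb]; have := IHm s sm sb.
rewrite mulSn expnD => cs; apply: (@leq_trans (2 ^ e.+1 * 2 ^ (m * b))).
  rewrite expnSr -mulnA ltn_mul2l expn_gt0 /=.
  by rewrite -muln2 mulnC; lia.
by rewrite leq_mul2r leq_exp2l // eb orbT.
Qed.

(** Folding over a coded list; the number of iterations is bounded by the code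
    itself, the superfluous ones being idle. *)
Definition code_foldl (f : nat -> nat -> nat) x c :=
  iteri c (fun j acc => if code_drop j c == 0 then acc else f acc (code_nth c j)) x.

Lemma code_foldlE f x s : code_foldl f x (code s) = foldl f x s.
Proof.
rewrite /code_foldl.
suff Ei i : iteri i (fun j acc => if code_drop j (code s) == 0 then acc else
    f acc (code_nth (code s) j)) x = foldl f x (take i s).
  by rewrite Ei take_oversize //; apply: leq_trans (size_le_code s); apply: leq_addr.
elim: i => [|i IHi] /=; first by rewrite take0.
rewrite IHi code_dropE code_eq0 -size_eq0 size_drop subn_eq0.
have [le_si|lt_is] := leqP (size s) i.
  by rewrite !take_oversize // ltnW.
by rewrite code_nthE // (take_nth 0) // foldl_rcons.
Qed.

End Arithmetic.

(** * The decision procedure *)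

Section Procedure.
Local Open Scope nat_scope.
(** [C] stands for the list of the codes of the letters, and [E] for a strict
    upper bound of it. *)
Variables (C : seq nat) (E : nat).
Implicit Types (n T w x i : nat).

(** The codes of a letter and of its inverse differ in the last bit. *)
Definition code_inv x := if odd x then x.-1 else x.+1.

(** A table [T] lists, for each code of a letter, the images of the points. Other
    numbers act trivially, so that every number is the code of a word. *)
Definition letter_step T x i := if x \in C then code_nth (code_nth T x) i else i.

Definition word_step T w i := code_foldl (fun i x => letter_step T x i) i w.

Definition table_valid n T :=
  forall_below E (fun x => forall_below n (fun i =>
    (letter_step T x i < n) && (letter_step T (code_inv x) (letter_step T x i) == i))).

Definition table_fixes T c :=
  forall_below c (fun j => (code_drop j c == 0) || (word_step T (code_nth c j) 0 == 0)).

(** Bounds for the words of length at most $n!$, the order of the symmetric group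
    of degree $n$, and for the tables of degree $n$. *)
Definition word_bound n := 2 ^ (n`! * E).
Definition table_bound n := 2 ^ (E * 2 ^ (n * n)).

(** [w] acts on the points like a value of the iterated commutator of depth
    [j]. Since $[u, v]$ is the solution $w$ of $v u w = u v$, no inverse word has
    to be computed. *)
Fixpoint comm_word j n T w : bool :=
  if j is j'.+1 then
    exists_below (word_bound n) (fun u => comm_word j' n T u &&
      exists_below (word_bound n) (fun v => comm_word j' n T v &&
        forall_below n (fun i => word_step T w (word_step T u (word_step T v i))
                                   == word_step T v (word_step T u i))))
  else true.

(** The base point is 0, and the degree is [n.+1] because it exists. *)
Definition decide k K c :=
  forall_below (3 * c + K) (fun n => forall_below (table_bound n.+1) (fun T =>
    table_valid n.+1 T ==> table_fixes T c ==>
    forall_below (word_bound n.+1) (fun w =>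
      comm_word k n.+1 T w ==> (word_step T w 0 == 0)))).

Implicit Types (F G H : seq nat -> nat).

Let rec_letter_step m F G H : rec_at m F -> rec_at m G -> rec_at m H ->
  rec_at m (fun v => letter_step (F v) (G v) (H v)).
Proof.
move=> rF rG rH; apply: rec_if => //; first exact: rec_mem.
by apply: rec_code_nth => //; apply: rec_code_nth.
Qed.

Let rec_word_step m F G H : rec_at m F -> rec_at m G -> rec_at m H ->
  rec_at m (fun v => word_step (F v) (G v) (H v)).
Proof.
apply: (@rec_comp3 m word_step).
apply: (@rec_iteri _ _ (fun j acc v => if code_drop j (nth 0 v 1) == 0 then acc
  else letter_step (nth 0 v 0) (code_nth (nth 0 v 1) j) acc)); [rec_var| |rec_var].
apply: rec_if; last 1 first.
- by apply: rec_letter_step; [| apply: rec_code_nth |]; rec_var.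
- by apply: rec_eq; [apply: rec_code_drop | apply: rec_const]; rec_var.
- by rec_var.
Qed.

Let rec_code_inv m F : rec_at m F -> rec_at m (fun v => code_inv (F v)).
Proof.
move=> rF; apply: rec_if; first exact: rec_odd.
  exact: rec_pred.
exact: rec_succ.
Qed.

Let rec_word_bound m F : rec_at m F -> rec_at m (fun v => word_bound (F v)).
Proof.
move=> rF; apply: rec_exp; first exact: rec_const.
by apply: rec_mul; [apply: rec_fact | apply: rec_const].
Qed.

Let rec_table_bound m F : rec_at m F -> rec_at m (fun v => table_bound (F v)).
Proof.
move=> rF; apply: rec_exp; first exact: rec_const.
apply: rec_mul; first exact: rec_const.
by apply: rec_exp; [apply: rec_const | apply: rec_mul].
Qed.

Let rec_table_valid m F G : rec_at m F -> rec_at m G ->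
  rec_at m (fun v => table_valid (F v) (G v)).
Proof.
apply: (@rec_comp2 m (fun a b => table_valid a b)); rewrite /table_valid.
apply: rec_forall; first exact: rec_const.
apply: rec_forall; first by rec_var.
apply: rec_and.
  by apply: rec_leq; [apply: rec_succ; apply: rec_letter_step|]; rec_var.
apply: rec_eq; last by rec_var.
apply: rec_letter_step; [rec_var | apply: rec_code_inv; rec_var |].
by apply: rec_letter_step; rec_var.
Qed.

Let rec_table_fixes m F G : rec_at m F -> rec_at m G ->
  rec_at m (fun v => table_fixes (F v) (G v)).
Proof.
apply: (@rec_comp2 m (fun a b => table_fixes a b)); rewrite /table_fixes.
apply: rec_forall; first by rec_var.
apply: rec_or; (apply: rec_eq; last exact: rec_const).
  by apply: rec_code_drop; rec_var.
apply: rec_word_step; [rec_var | | exact: rec_const].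
by apply: rec_code_nth; rec_var.
Qed.

Let rec_comm_word j m F G H : rec_at m F -> rec_at m G -> rec_at m H ->
  rec_at m (fun v => comm_word j (F v) (G v) (H v)).
Proof.
elim: j m F G H => [|j IHj] m F G H; first by move=> *; apply: rec_const.
apply: (@rec_comp3 m (fun a b c => comm_word j.+1 a b c)) => /=.
apply: rec_exists; first by apply: rec_word_bound; rec_var.
apply: rec_and; first by apply: IHj; rec_var.
apply: rec_exists; first by apply: rec_word_bound; rec_var.
apply: rec_and; first by apply: IHj; rec_var.
apply: rec_forall; first by rec_var.
by apply: rec_eq; do 3! [apply: rec_word_step; [rec_var|rec_var|try rec_var]]; rec_var.
Qed.

Lemma rec_decide k K : recursive_set (decide k K).
Proof.
suff: rec_at 1 (fun v => decide k K (nth 0 v 0)).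
  rewrite /rec_at /recursive_set; congr recursive; apply: funext => v.
  by rewrite /thead (tnth_nth 0).
apply: rec_forall.
  apply: rec_add; last exact: rec_const.
  by apply: rec_mul; [apply: rec_const | rec_var].
apply: rec_forall; first by apply: rec_table_bound; apply: rec_succ; rec_var.
apply: rec_imply; first by apply: rec_table_valid; [apply: rec_succ|]; rec_var.
apply: rec_imply; first by apply: rec_table_fixes; rec_var.
apply: rec_forall; first by apply: rec_word_bound; apply: rec_succ; rec_var.
apply: rec_imply; first by apply: rec_comm_word; [apply: rec_succ| |]; rec_var.
apply: rec_eq; last exact: rec_const.
by apply: rec_word_step; [rec_var|rec_var|exact: rec_const].
Qed.

Lemma code_invK : involutive code_inv.
Proof.
by rewrite /code_inv => -[|x] //=; case Ox: (odd x); rewrite /= ?Ox.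
Qed.

Lemma word_stepE T s i :
  word_step T (CodeSeq.code s) i = foldl (fun i x => letter_step T x i) i s.
Proof. exact: code_foldlE. Qed.

Lemma table_fixesP T (s : seq (seq nat)) :
  reflect (forall u, u \in s -> word_step T (CodeSeq.code u) 0 = 0)
    (table_fixes T (CodeSeq.code (map CodeSeq.code s))).
Proof.
apply: (iffP (forall_belowP _ _)) => fixT.
  move=> u us; have ltus : index u s < size s by rewrite index_mem.
  have := fixT (index u s); rewrite code_dropE code_eq0 code_nthE ?size_map //.
  rewrite (nth_map u) // nth_index // -size_eq0 size_drop size_map subn_eq0.
  rewrite [size s <= _]leqNgt ltus /=.
  move/(_ _)/eqP; apply; apply: leq_trans (size_le_code _).
  by rewrite size_map; apply: leq_trans ltus _; apply: leq_addr.
move=> j _; rewrite code_dropE code_eq0 -size_eq0 size_drop size_map subn_eq0.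
have [//|lt_js] := leqP (size s) j.
rewrite code_nthE ?size_map // (nth_map [::]) //=.
by apply/eqP/fixT/mem_nth.
Qed.

End Procedure.

(** ** Correctness *)

Section Correctness.
Variables (A : choiceType) (enc : A -> nat) (ls : seq (letter A)).
Hypotheses (encI : injective enc) (lsP : forall l, l \in ls).
Notation F := (free_group A).
Notation lc := (letter_code enc).
Let C := map lc ls.
Variable E : nat.
Hypothesis CE : forall l, (lc l < E)%N.
Implicit Types (g h x : F) (l : letter A) (u : seq (letter A)).

Let letter_code_inj : injective lc.
Proof.
move=> [a b] [a' b'] /eqP; rewrite /letter_code /= => /eqP Eab.
have Eb : b = b'.
  by have := congr1 odd Eab; rewrite !oddD !odd_double; case: (b); case: (b').
by move: Eab; rewrite Eb => /addIn/double_inj/encI ->.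
Qed.

Let letter_code_inv l : lc (letter_inv l) = code_inv (lc l).
Proof.
case: l => a b; rewrite /letter_code /letter_inv /code_inv /= oddD odd_double.
by case: b; rewrite /= ?addn1 ?addn0.
Qed.

Definition word_prod u : F := foldr (fun l g => of_letter l * g) 1 u.

Lemma word_prodK g : word_prod (word_of g) = g.
Proof.
suff Eu u : reduced u -> word_of (word_prod u) = u.
  by apply: free_inj; apply: Eu; apply: word_of_reduced.
elim: u => [//|l u IHu] ru; have {}IHu := IHu (path_sorted ru).
by rewrite [word_prod _]/= word_of_mul IHu.
Qed.

(** Validity makes the actions of a letter and of its inverse letter mutually
    inverse permutations of the points. *)
Lemma table_representation n T : table_valid C E n T ->
  exists rho : {multiplicative F -> {perm 'I_n}}, forall l (i : 'I_n),
    rho (of_letter l) i = letter_step C T (lc l) i :> nat.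
Proof.
move=> /forall_belowP valT; pose st l i := letter_step C T (lc l) i.
have stP l i : (i < n)%N -> (st l i < n)%N /\ st (letter_inv l) (st l i) = i.
  move=> ltin; have /forall_belowP/(_ i ltin)/andP[] := valT _ (CE l).
  by rewrite /st letter_code_inv => ? /eqP.
pose so l (i : 'I_n) := Ordinal (stP l i (ltn_ord i)).1.
have soK l : cancel (so l) (so (letter_inv l)).
  by move=> i; apply: val_inj; rewrite /= (stP l i (ltn_ord i)).2.
pose sp a : {perm 'I_n} := perm (can_inj (soK (a, true))).
exists (free_lift sp) => -[a []] i; rewrite free_lift_letter; first by rewrite permE.
have -> : i = sp a (so (a, false) i) by rewrite permE (soK (a, false)).
by rewrite permK permE (soK (a, false)).
Qed.

Let generators_codeE s : generators_code enc s =
  CodeSeq.code (map CodeSeq.code [seq map lc (word_of g) | g <- s]).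
Proof. by rewrite -map_comp. Qed.

Section Soundness.
Variables (n T : nat) (rho : {multiplicative F -> {perm 'I_n}}).
Hypothesis rhoP : forall l (i : 'I_n),
  rho (of_letter l) i = letter_step C T (lc l) i :> nat.

Let word_step_word g (i : 'I_n) :
  word_step C T (word_code enc (word_of g)) i = rho g i.
Proof.
rewrite word_stepE -{2}[g]word_prodK.
elim: (word_of g) i => [|l u IHu] i /=; first by rewrite multiplicative1 perm1.
by rewrite gmulfM permM -rhoP IHu.
Qed.

Let word_step_code w : exists x, forall i : 'I_n, word_step C T w i = rho x i.
Proof.
rewrite -(CodeSeq.decodeK w); elim: (CodeSeq.decode w) => [|y s [x IHs]].
  by exists 1 => i; rewrite word_stepE multiplicative1 perm1.
have [/mapP[l _ Ey]|yC] := boolP (y \in C).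
  exists (of_letter l * x) => i; rewrite word_stepE /= Ey -rhoP.
  by rewrite -word_stepE IHs gmulfM permM.
exists x => i; rewrite word_stepE /= {2}/letter_step (negPf yC) -word_stepE.
exact: IHs.
Qed.

Lemma comm_word_sound j w : comm_word C E j n T w ->
  exists2 x, comm_values j x & forall i : 'I_n, word_step C T w i = rho x i.
Proof.
elim: j w => [|j IHj] w /=.
  by move=> _; have [x xP] := word_step_code w; exists x.
case/exists_belowP => u _ /andP[/IHj[x jx xP] /exists_belowP[v _]].
case/andP=> /IHj[y jy yP] /forall_belowP comm.
have [z zP] := word_step_code w.
exists [~ x, y]; first by exists x => //; exists y.
move=> i0; rewrite zP; congr (nat_of_ord (fun_of_perm _ i0)).
rewrite multiplicativeR; apply: (mulgI (rho y * rho x)).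
rewrite -commgC; apply/permP => i; rewrite !permM.
apply: val_inj; have /eqP := comm i (ltn_ord i).
by rewrite !(xP, yP, zP).
Qed.

Lemma table_fixes_gens s (i : 'I_n) : i = 0%N :> nat ->
  table_fixes C T (generators_code enc s) ->
  forall g, g \in s -> rho g i = i.
Proof.
move=> i0; rewrite generators_codeE => /table_fixesP fixT g gs.
apply: val_inj => /=; rewrite -word_step_word i0; apply: fixT.
exact: (map_f (fun g => map lc (word_of g))).
Qed.

End Soundness.

Lemma decide_sound k K s : derived_subgroup F k `<=` generated [set` s] ->
  decide C E k K (generators_code enc s).
Proof.
move=> kH; apply/forall_belowP => n _; apply/forall_belowP => T _.
apply/implyP => /table_representation[rho rhoP]; apply/implyP => fixT.
have fix0 := table_fixes_gens rhoP (erefl : ord0 = 0%N :> nat) fixT.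
apply/forall_belowP => w _; apply/implyP => /(comm_word_sound rhoP)[x kx xP].
rewrite (xP ord0); apply/eqP.
suff -> : rho x ord0 = ord0 by [].
have Hx := kH _ (comm_values_derived kx).
apply: (Hx [set x | rho x ord0 = ord0]); split=> [|g /= gs]; last exact: fix0.
split=> /= [|g h gfix hfix]; first by rewrite multiplicative1 perm1.
by rewrite gmulfM permM gfix multiplicativeV -{1}hfix permK.
Qed.

(** In a finite group generated by the images of the letters, every element is
    the image of a word no longer than the order of the group: a path in the
    Cayley graph can be made simple. *)
Lemma short_word (T : finType) (rho : {multiplicative F -> {perm T}}) x :
  exists2 u, (size u <= (#|T|)`!)%N & rho (word_prod u) = rho x.
Proof.
pose e : rel {perm T} := fun p q => has (fun l => q == p * rho (of_letter l)) ls.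
have [p ep px] : exists2 p, path e 1 p & last 1 p = rho x.
  elim/free_ind: x => [|g l [p ep pg]].
    by exists [::]; rewrite //= multiplicative1.
  exists (rcons p (rho (g * of_letter l))); last by rewrite last_rcons.
  rewrite rcons_path ep pg /=; apply/hasP; exists l => //.
  by rewrite gmulfM.
move: px; case/shortenP: ep => q eq uq _ qx.
have [u su uE] : exists2 u, size u = size q &
    last 1 q = 1 * rho (word_prod u).
  elim: q (1 : {perm T}) eq {uq qx} => [|p' q IHq] r /=.
    by exists [::]; rewrite //= multiplicative1 mulg1.
  case/andP=> /hasP[l _ /eqP rp'] /IHq[u su uE].
  exists (l :: u); first by rewrite /= su.
  by rewrite uE rp' /= gmulfM mulgA.
exists u; last by rewrite -qx uE mul1g.
rewrite su; apply: ltnW; apply: leq_trans (_ : #|{perm T}| <= _)%N.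
  by have := card_uniqP uq => /= <-; apply: max_card.
rewrite -cardsT -card_perm; apply: subset_leq_card; apply/fintype.subsetP => r _.
by apply/fintype.subsetP => t _; rewrite inE.
Qed.

Section Completeness.
Variables (T : finType) (rho : {multiplicative F -> {perm T}}) (t0 : T).

(** The base point comes first, as the procedure looks at the point 0. *)
Let points := t0 :: rem t0 (enum T).
Let n := #|T|.
Let num t := index t points.
Let pt i := nth t0 points i.

Let perm_points : perm_eq points (enum T).
Proof. by rewrite perm_sym; apply: perm_to_rem; rewrite mem_enum. Qed.

Let size_points : size points = n.
Proof. by rewrite (perm_size perm_points) -cardE. Qed.

Let numK : cancel num pt.
Proof.
by move=> t; apply: nth_index; rewrite (perm_mem perm_points) mem_enum.
Qed.

Let ptK i : (i < n)%N -> num (pt i) = i.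
Proof.
move=> ltin; apply: index_uniq; rewrite ?size_points //.
by rewrite (perm_uniq perm_points) enum_uniq.
Qed.

Let num_lt t : (num t < n)%N.
Proof. by rewrite -size_points index_mem (perm_mem perm_points) mem_enum. Qed.

Let num0 : num t0 = 0%N.
Proof. by rewrite /num /= eqxx. Qed.

Let entry (c i : nat) := num (rho (nth 1 (map (@of_letter A) ls) (index c C)) (pt i)).
Let row (c : nat) := CodeSeq.code [seq entry c i | i <- iota 0 n].
Let table := CodeSeq.code [seq row c | c <- iota 0 E].

Let step_entry (x i : nat) : (i < n)%N -> letter_step C table x i = entry x i.
Proof.
move=> ltin; rewrite /letter_step; case: ifP => [xC|xC].
  have ltxE : (x < E)%N by case/mapP: xC => l _ ->; apply: CE.
  rewrite /table code_nthE ?size_map ?size_iota // (nth_map 0%N) ?size_iota //.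
  rewrite nth_iota // code_nthE ?size_map ?size_iota //.
  by rewrite (nth_map 0%N) ?size_iota // nth_iota.
rewrite /entry nth_default; first by rewrite multiplicative1 perm1 ptK.
by rewrite size_map -(size_map lc) leqNgt index_mem xC.
Qed.

Let entry_letter l i : entry (lc l) i = num (rho (of_letter l) (pt i)).
Proof.
rewrite /entry index_map // (nth_map l) ?nth_index ?lsP //.
by rewrite index_mem lsP.
Qed.

Let step_letter l t : letter_step C table (lc l) (num t) = num (rho (of_letter l) t).
Proof. by rewrite step_entry // entry_letter numK. Qed.

Let word_step_prod u t :
  word_step C table (word_code enc u) (num t) = num (rho (word_prod u) t).
Proof.
rewrite word_stepE; elim: u t => [|l u IHu] t /=.
  by rewrite multiplicative1 perm1.
by rewrite step_letter IHu gmulfM permM.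
Qed.

Let table_lt : (table < table_bound E n)%N.
Proof.
apply: code_lt; first by rewrite size_map size_iota.
apply/allP => _ /mapP[x _ ->]; apply: code_lt; first by rewrite size_map size_iota.
by apply/allP => _ /mapP[i _ ->]; apply: num_lt.
Qed.

Let table_is_valid : table_valid C E n table.
Proof.
apply/forall_belowP => x _; apply/forall_belowP => i ltin.
have [/mapP[l _ ->]|xC] := boolP (x \in C).
  rewrite -letter_code_inv -(ptK ltin) !step_letter num_lt -of_letterV.
  by rewrite multiplicativeV permK eqxx.
have ixC : code_inv x \notin C.
  apply: contra xC => /mapP[l _ Ex].
  by rewrite -(code_invK x) Ex -letter_code_inv; apply: map_f.
by rewrite /letter_step (negPf xC) (negPf ixC) ltin eqxx.
Qed.

Let comm_word_complete j x w : comm_values j x ->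
  (forall t, word_step C table w (num t) = num (rho x t)) ->
  comm_word C E j n table w.
Proof.
have short y : exists2 u, (word_code enc u < word_bound E n)%N &
    rho (word_prod u) = rho y.
  have [u su uy] := short_word rho y; exists u => //; apply: code_lt.
    by rewrite size_map.
  by apply/allP => _ /mapP[l _ ->]; apply: CE.
elim: j x w => //= j IHj _ w [y jy [z jz <-]] wP.
have [u ult uy] := short y; have [v vlt vz] := short z.
apply/exists_belowP; exists (word_code enc u) => //; apply/andP; split.
  by apply: IHj jy _ => t; rewrite word_step_prod uy.
apply/exists_belowP; exists (word_code enc v) => //; apply/andP; split.
  by apply: IHj jz _ => t; rewrite word_step_prod vz.
apply/forall_belowP => i /ptK <-; rewrite !word_step_prod wP.
by rewrite -!permM uy vz multiplicativeR mulgA -commgC.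
Qed.

Lemma decide_complete k K s y :
  (n <= 3 * generators_code enc s + K)%N ->
  (forall g, g \in s -> rho g t0 = t0) -> comm_values k y -> rho y t0 != t0 ->
  ~~ decide C E k K (generators_code enc s).
Proof.
move=> ltn fixs ky yt0; have n0 : n.-1.+1 = n.
  by apply: ltn_predK (num_lt t0).
apply: contra yt0 => /forall_belowP/(_ n.-1); rewrite n0 => /(_ ltn)/forall_belowP.
move/(_ table table_lt); rewrite table_is_valid implyTb.
have -> : table_fixes C table (generators_code enc s).
  rewrite generators_codeE; apply/table_fixesP => _ /mapP[g gs ->].
  by have := word_step_prod (word_of g) t0; rewrite word_prodK fixs // num0.
have [u su uy] := short_word rho y; rewrite implyTb => /forall_belowP.
move/(_ (word_code enc u)); rewrite (comm_word_complete ky) => [|t].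
  have -> : word_step C table (word_code enc u) 0 = num (rho y t0).
    by rewrite -uy -word_step_prod num0.
  rewrite implyTb => yt0; apply/eqP/(can_inj numK); rewrite num0; apply/eqP/yt0.
  apply: code_lt; first by rewrite size_map.
  by apply/allP => _ /mapP[l _ ->]; apply: CE.
by rewrite word_step_prod uy.
Qed.

End Completeness.

End Correctness.

(** ** A bound for the degree *)

Section Degree.
Variable A : choiceType.
Notation F := (free_group A).
Implicit Types (g h x y p : F) (s : seq F).

Lemma size_mul g h :
  (size (word_of (g * h)%g) <= size (word_of g) + size (word_of h))%N.
Proof.
rewrite -[word_of (g * h)]/(word_mul (word_of g) (word_of h)).
elim: (word_of g) => //= l u IHu.
apply: leq_trans (_ : (size (word_mul u (word_of h))).+1 <= _)%N => //.
by case: (word_mul _ _) => //= m w; case: ifP => // _; apply: leqW.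
Qed.

Lemma size_inv g : size (word_of g^-1) = size (word_of g).
Proof. by rewrite /= size_rev size_map. Qed.

Definition total_length s := sumn [seq (size (word_of g)).+1 | g <- s].

Lemma size_prefixes s : size (prefixes s) = (total_length s).+1.
Proof.
rewrite /= size_flatten /shape -map_comp; congr (sumn _).+1.
by apply: eq_map => g /=; rewrite size_map size_iota.
Qed.

Lemma size_mem_prefixes s p :
  p \in prefixes s -> (size (word_of p) <= total_length s)%N.
Proof.
case/prefixesP=> [->//|[g gs [n ->]]]; rewrite word_of_take size_take_min.
apply: leq_trans (geq_minr _ _) _.
elim: s gs => // h s IHs; rewrite inE /total_length /= => /orP[/eqP <-|/IHs].
  by rewrite leqW // leq_addr.
by move/leq_trans; apply; apply: leq_addl.
Qed.

Lemma total_length_le enc s : (total_length s <= generators_code enc s)%N.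
Proof.
apply: leq_trans (size_le_code _); rewrite size_map.
elim: s => //= g s; rewrite /total_length /= => IHs.
have := size_le_code (map (letter_code enc) (word_of g)).
rewrite size_map -/(word_code enc (word_of g)); lia.
Qed.

(** If a finitely generated subgroup does not contain the k-th derived
    subgroup, this is detected by a permutation representation of bounded
    degree: the action on all the cosets when the prefixes of the generators
    represent all of them, and otherwise a completion of a finite part of the
    Schreier graph along which a short conjugate of a fixed element [n] can be
    read. *)
Lemma moving_representation (a b : A) k (n : F) (H : set F) s : a != b ->
  comm_values k n -> n != 1 -> H = generated [set` s] ->
  ~ (derived_subgroup F k `<=` H) ->
  exists (T : finType) (rho : {multiplicative F -> {perm T}}) (t : T) (y : F),
  [/\ (#|T| <= 3 * total_length s + (size (word_of n) + 7))%N,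
      forall g, g \in s -> rho g t = t, comm_values k y & rho y t != t].
Proof.
move=> ab kn n1 HE kH; have sH : is_subgroup H by rewrite HE; apply: generated_subgroup.
have main xs y : (size xs <= 3 * total_length s + (size (word_of n) + 7))%N ->
    {subset prefixes s <= xs} -> (forall i, covered H xs (free_take i y)) ->
    comm_values k y -> ~ H y ->
    exists (T : finType) (rho : {multiplicative F -> {perm T}}) (t : T) (y : F),
    [/\ (#|T| <= 3 * total_length s + (size (word_of n) + 7))%N,
      forall g, g \in s -> rho g t = t, comm_values k y & rho y t != t].
  move=> sxs sub_xs covy ky Hy.
  have xs1 : 1 \in xs by apply: sub_xs; apply: mem_head.
  have [T [rho [c [cT cP _ rhoE]]]] := coset_representation sH xs1.
  have cov1 : covered H xs 1 by apply: covered_mem.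
  have covg g i : g \in s -> covered H xs (free_take i g).
    by move=> gs; apply: covered_mem => //; apply: sub_xs; apply: mem_prefixes.
  have cov g : (forall i, covered H xs (free_take i g)) -> covered H xs g.
    by move=> covg'; rewrite -(free_take_ge (leqnn (size (word_of g)))).
  exists T, rho, (c 1), y; split=> //; first exact: leq_trans cT sxs.
    move=> g gs; rewrite rhoE => [|i]; last by rewrite mul1g; apply: covg.
    rewrite mul1g; apply/cP => //; first by apply: cov => i; apply: covg.
    by rewrite invg1 mulg1 HE; apply: sub_generated.
  apply/eqP; rewrite rhoE => [|i]; last by rewrite mul1g.
  by rewrite mul1g => /(cP _ _ (cov y covy) cov1); rewrite invg1 mulg1.
have [covH|] := pselect (forall g, covered H (prefixes s) g).
  have [y ky Hy] : exists2 y, comm_values k y & ~ H y.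
    apply: contrapT => nH; apply: kH; apply/derived_sub => // y ky.
    by apply: contrapT => Hy; apply: nH; exists y.
apply: (main (prefixes s)) Hy => //; rewrite size_prefixes; lia.
case/(short_conj_notin ab n1 HE) => p ps [l [z]].
set y := n ^ _ => Hy; apply: (main (prefixes s ++ prefixes [:: y])) Hy.
- rewrite size_cat !size_prefixes.
  have -> : total_length [:: y] = (size (word_of y)).+1 by rewrite -[RHS]addn0.
  (* Conjugation adds a prefix and two letters on either side of n. *)
  have : (size (word_of y) <= 2 * (size (word_of p) + 2) + size (word_of n))%N.
    rewrite /y conjgE invgK.
    set q := p * _ * _; have sq : (size (word_of q) <= size (word_of p) + 2)%N.
      apply: leq_trans (size_mul _ _) _; rewrite addn2 -addn1 leq_add2r.
      by apply: leq_trans (size_mul _ _) _; rewrite addn1.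
    apply: leq_trans (size_mul _ _) _.
    rewrite mul2n -addnn -addnA; apply: leq_add => //.
    by rewrite addnC; apply: leq_trans (size_mul _ _) _; rewrite size_inv leq_add2l.
  move: (size_mem_prefixes ps).
  move: (size (word_of y)) (size (word_of p)) (total_length s) (size (word_of n)).
  lia.
- by move=> g gs; rewrite mem_cat gs.
- move=> i; apply: covered_mem => //; rewrite mem_cat; apply/orP; right.
  by apply: mem_prefixes; rewrite mem_head.
- exact: comm_valuesJ.
Qed.

End Degree.

(** * The theorem *)

Section Main.
Variable A : choiceType.
Notation F := (free_group A).
Implicit Types (s : seq F) (k : nat) (c : A).

Lemma sub_derived_letter (a b : A) k s c : a != b ->
  derived_subgroup F k `<=` generated [set` s] ->
  exists2 g, g \in s & exists2 l, l \in word_of g & l.1 = c.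
Proof.
move=> ab kH; apply: contrapT => sc.
apply: (@not_covered_letter A _ s c erefl); last exact: covered_all ab erefl kH.
move=> g l gs lg; apply/eqP => lc; apply: sc.
by exists g => //; exists l.
Qed.

Lemma finite_alphabet (a b : A) k s : a != b ->
  derived_subgroup F k `<=` generated [set` s] -> finite_set [set: A].
Proof.
move=> ab kH.
apply: (@sub_finite_set _ _ [set` [seq l.1 | l <- flatten [seq word_of g | g <- s]]]).
  move=> c _ /=; have [g gs [l lg <-]] := sub_derived_letter c ab kH.
  by apply: map_f; apply/flatten_mapP; exists g.
exact: finite_seq.
Qed.

Lemma closed_derived k s : (1 <= k)%N ->
  pro_closed (finite_solvable k) (generated [set` s] : set F) ->
  derived_subgroup F k `<=` generated [set` s].
Proof.
move=> k1 <-; apply: derived_sub_closure; exact: generated_subgroup.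
Qed.

Lemma two_letters : ~ (forall a b : A, a = b) -> exists a b : A, a != b.
Proof.
move/existsNP => [a /existsNP[b /eqP ab]]; by exists a, b.
Qed.

(** The procedure serves only when the letters are finitely many, at least two,
    and all named by the encoding; in the other cases the answer is constant,
    since a subgroup containing the k-th derived subgroup involves every letter
    in its generators. *)
Lemma decidable_closed k : (1 <= k)%N ->
  decidable_fg (fun H : set F => pro_closed (finite_solvable k) H).
Proof.
move=> k1 B enc encB.
have [A1|/two_letters[a [b ab]]] := pselect (forall a b : A, a = b).
  exists (fun=> true); first by apply: (@rec_const 1 1).
  by move=> s _; split=> // _; apply: rank1_closed.
have closedP s : pro_closed (finite_solvable k) (generated [set` s] : set F) <->
    derived_subgroup F k `<=` generated [set` s].
  by split; [apply: closed_derived | apply: sub_derived_closed ab _].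
have [[Afin BT]|nfin] := pselect (finite_set [set: A] /\ B = setT); last first.
  exists (fun=> false); first by apply: (@rec_const 1 0).
  move=> s sB; split=> // /closedP kH; case: nfin; split.
    exact: finite_alphabet ab kH.
  apply/seteqP; split=> // c _; have [g gs [l lg <-]] := sub_derived_letter c ab kH.
  exact: sB gs lg.
have encI : injective enc by move=> x y; apply: encB; apply/mem_set; rewrite BT.
have [ls lsP] := finite_letters Afin.
pose E := (\max_(l <- ls) letter_code enc l).+1.
have CE l : (letter_code enc l < E)%N by rewrite ltnS leq_bigmax_seq.
have [n kn n1] := comm_values_neq1 k ab.
exists (decide (map (letter_code enc) ls) E k (size (word_of n) + 7)).
  exact: rec_decide.
move=> s _; rewrite closedP; split=> [|kH]; last exact: decide_sound.
apply: contraPP => kH.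
have [T [rho [t [y [sT fixs ky yt]]]]] := moving_representation ab kn n1 erefl kH.
apply/negP; apply: decide_complete fixs ky yt => //.
apply: leq_trans sT _; rewrite leq_add2r leq_mul2l /=; exact: total_length_le.
Qed.

End Main.

Theorem theorem4p2 (A : choiceType) (k : nat) : (1 <= k)%N ->
  (forall H : set (free_group A), is_subgroup H -> finitely_generated H ->
    let Cl := pro_closure (finite_solvable k) H in
    [/\ set_prod H (derived_subgroup (free_group A) k) `<=` Cl,
        infinite_set [set: A] -> ~ finitely_generated Cl
      & finite_set [set: A] ->
        ~ ((exists a : A, [set: A] = [set a]) /\ H = [set 1]) ->
        (finitely_generated Cl <-> finite_index Cl)])
  /\ decidable_fg (fun H : set (free_group A) =>
       pro_closed (finite_solvable k) H).
Proof.
move=> k1; split=> [H sH _ Cl|]; last exact: decidable_closed.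
have sCl : is_subgroup Cl by apply: pro_closure_subgroup.
have HCl : H `<=` Cl by apply: sub_pro_closure.
have kCl : derived_subgroup (free_group A) k `<=` Cl by apply: derived_sub_closure.
split=> [_ [h Hh [x kx <-]]|Ainf|Afin nontriv].
- by apply: (subgroupM sCl); [apply: HCl | apply: kCl].
- case/finitely_generatedP => s ClE; apply: Ainf.
  have [A1|/two_letters[a [b ab]]] := pselect (forall a b : A, a = b).
    have [[a _]|/nonemptyPn ->] := pselect ([set: A] !=set0); last exact: finite_set0.
    have -> : [set: A] = [set a] by apply/seteqP; split=> // b _; apply: A1.
    exact: finite_set1.
  by apply: (finite_alphabet (k := k) (s := s) ab); rewrite -ClE.
split; last exact: finite_index_fg.
case/finitely_generatedP => s ClE.
have [A1|/two_letters[a [b ab]]] := pselect (forall a b : A, a = b); last first.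
  apply/(finite_indexP sCl); exists (prefixes s) => g.
  exact: covered_all ab ClE kCl.
have [[h [Hh h1]]|H1] := pselect (exists h, H h /\ h != 1).
  exact: rank1_finite_index sCl A1 (HCl _ Hh) h1.
have HE : H = [set 1].
  apply/seteqP; split=> [h Hh|_ ->]; last exact: sH.1.
  by apply: contrapT => /eqP h1; apply: H1; exists h.
apply/(finite_indexP sCl); exists [:: 1] => g; exists 1; first exact: mem_head.
suff -> : g = 1 by rewrite mulgV; apply: sCl.1.
elim/free_ind: g => [//|g [a b] _]; case: nontriv; split=> //; exists a.
by apply/seteqP; split=> // b _; apply: A1.
Qed.
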